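(* There is a complete first-order theory $T$ which has $\mathrm{TP}_2$ and such that forking in $T$ satisfies the chain condition over every (small) set $A$.
   Context: A formula $\varphi(x,y)$ is $\mathrm{TP}_2$ if there are $(a_{ij})_{i,j\in\omega}$ (in a monster model) and $k\in\omega$ such that $\{\varphi(x,a_{ij})\}_{j\in\omega}$ is $k$-inconsistent for each $i\in\omega$, while $\{\varphi(x,a_{if(i)})\}_{i\in\omega}$ is consistent for each $f:\omega\to\omega$. $T$ has $\mathrm{TP}_2$ if some formula is $\mathrm{TP}_2$. Forking in $T$ satisfies the chain condition over a set $A$ if whenever $(a_i)_{i\in\omega}$ is an $A$-indiscernible sequence and $\varphi(x,a_0)$ does not fork over $A$, then $\varphi(x,a_0)\wedge\varphi(x,a_1)$ does not fork over $A$. *)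

(* Defs.v *)
From mathcomp Require Import all_boot.
From mathcomp Require Import boolp classical_sets functions cardinality.

Set Implicit Arguments.
Unset Strict Implicit.
Unset Printing Implicit Defensive.

Local Open Scope classical_set_scope.
Local Open Scope card_scope.

(** * Single-sorted first-order logic *)

Record language := Language {
  fsym : Type;
  farity : fsym -> nat;
  rsym : Type;
  rarity : rsym -> nat }.

(** The free variables of a term or formula are drawn from an arbitrary type
    [V]; a quantifier binds the variable [None] of [option V].  Thus
    [formula L ('I_n + 'I_m)] is the type of formulas phi(x, y) with x an
    n-tuple and y an m-tuple, and, for a set [A] of parameters,
    [formula L ('I_n + A)] is the type of L(A)-formulas in x: an element of
    [A] is used as a variable that is always assigned itself. *)
Inductive term (L : language) (V : Type) : Type :=
| Var of V
| App (f : fsym L) of ('I_(farity f) -> term L V).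

Inductive formula (L : language) (V : Type) : Type :=
| Bot
| Eq of term L V & term L V
| Rel (r : rsym L) of ('I_(rarity r) -> term L V)
| Imp of formula L V & formula L V
| All of formula L (option V).

Arguments Bot {L V}.

Definition Not L (V : Type) (phi : formula L V) : formula L V := Imp phi Bot.

Definition sentence (L : language) := formula L void.

Record structure (L : language) := Structure {
  carrier :> Type;
  carrier_inhabited : inhabited carrier;
  fint : forall f : fsym L, ('I_(farity f) -> carrier) -> carrier;
  rint : forall r : rsym L, ('I_(rarity r) -> carrier) -> Prop }.

Fixpoint eval L (M : structure L) (V : Type) (v : V -> M) (t : term L V) : M :=
  match t with
  | Var x => v x
  | App f ts => fint (fun i => eval v (ts i))
  end.

Definition extend (X V : Type) (v : V -> X) (x : X) (o : option V) : X :=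
  if o is Some y then v y else x.

Fixpoint holds L (M : structure L) (V : Type) (phi : formula L V) : (V -> M) -> Prop :=
  match phi with
  | Bot => fun=> False
  | Eq s t => fun v => eval v s = eval v t
  | Rel r ts => fun v => rint (fun i => eval v (ts i))
  | Imp phi1 phi2 => fun v => holds phi1 v -> holds phi2 v
  | All phi1 => fun v => forall x : M, holds phi1 (extend v x)
  end.

Definition models L (T : set (sentence L)) (M : structure L) :=
  forall s, T s -> holds s (of_void M).

Definition entails L (T : set (sentence L)) (s : sentence L) :=
  forall M : structure L, models T M -> holds s (of_void M).

Definition complete L (T : set (sentence L)) :=
  (exists M : structure L, models T M) /\
  (forall s, entails T s \/ entails T (Not s)).

(** [sol phi b] is the set of solutions in [M] of the formula phi(x, b). *)
Definition sol L (M : structure L) (X Y : Type)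
    (phi : formula L (X + Y)) (b : Y -> M) : set (X -> M) :=
  [set c | holds phi (fun z => match z with inl x => c x | inr y => b y end)].

(** Consistency of the family of formulas defining the [X i], [i] in [D]:
    by compactness, satisfiability in [M] of each finite subfamily. *)
Definition consistent (U I : Type) (D : set I) (X : I -> set U) :=
  forall J : set I, finite_set J -> J `<=` D -> \bigcap_(i in J) X i !=set0.

(** The members of the family are counted with their indices, so that the
    constant family with a nonempty value is not k-inconsistent. *)
Definition k_inconsistent (U : Type) (k : nat) (X : nat -> set U) :=
  forall J : set nat, J #= `I_k -> ~ (\bigcap_(i in J) X i !=set0).

(** * Monster models *)

(** With kappa = |K|^+, [A] is small when |A| < kappa, i.e. |A| <= |K|. *)
Definition small (K U : Type) (A : set U) := A #<= [set: K].

Definition saturated (K : Type) L (M : structure L) :=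
  forall (A : set M), small K A ->
  forall (n : nat) (p : set (formula L ('I_n + A))),
    consistent p (fun phi => sol phi (@set_val M A)) ->
    \bigcap_(phi in p) sol phi (@set_val M A) !=set0.

(** A monster model of [T] is a kappa-saturated model, where
    kappa = |K|^+ > |L| and |L| is the number of L-formulas. *)
Definition monster L (T : set (sentence L)) (K : Type) (M : structure L) :=
  [/\ models T M, [set: formula L nat] #<= [set: K] & saturated K M].

(** * TP2 *)

Definition is_TP2 L (T : set (sentence L)) n m
    (phi : formula L ('I_n + 'I_m)) :=
  exists (K : Type) (M : structure L), monster T K M /\
  exists (a : nat -> nat -> 'I_m -> M) (k : nat),
    (forall i, k_inconsistent k (fun j => sol phi (a i j))) /\
    (forall f : nat -> nat,
       consistent [set: nat] (fun i => sol phi (a i (f i)))).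

Definition has_TP2 L (T : set (sentence L)) :=
  exists n m (phi : formula L ('I_n + 'I_m)), is_TP2 T phi.

(** * Forking *)

Section Forking.
Variables (L : language) (M : structure L) (A : set M).

Definition same_type (X : Type) (a b : X -> M) :=
  forall phi : formula L (X + A),
    sol phi (@set_val M A) a <-> sol phi (@set_val M A) b.

Definition indiscernible m (a : nat -> 'I_m -> M) :=
  forall (k : nat) (s t : 'I_k -> nat),
    {homo s : i j / (i < j)%N} -> {homo t : i j / (i < j)%N} ->
    same_type (fun z : 'I_k * 'I_m => a (s z.1) z.2)
              (fun z : 'I_k * 'I_m => a (t z.1) z.2).

Definition divides n m (phi : formula L ('I_n + 'I_m)) (a : 'I_m -> M) :=
  exists (k : nat) (b : nat -> 'I_m -> M),
    (forall i, same_type (b i) a) /\ k_inconsistent k (fun i => sol phi (b i)).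

(** Forking is stated for the solution set of a formula with parameters, on
    which alone it depends; conjunctions become intersections. *)
Definition forks n (X : set ('I_n -> M)) :=
  exists (r : nat) (m : 'I_r -> nat)
         (psi : forall i, formula L ('I_n + 'I_(m i)))
         (b : forall i, 'I_(m i) -> M),
    (forall i, divides (psi i) (b i)) /\
    X `<=` \bigcup_i sol (psi i) (b i).

Definition chain_condition :=
  forall n m (phi : formula L ('I_n + 'I_m)) (a : nat -> 'I_m -> M),
    indiscernible a ->
    ~ forks (sol phi (a 0)) ->
    ~ forks (sol phi (a 0) `&` sol phi (a 1)).

End Forking.

(* Main.v *)
Require Import Defs.
From mathcomp Require Import all_boot.
From mathcomp Require Import boolp classical_sets functions cardinality.
From mathcomp Require Import filter.

(** [T] is the theory of atomless Boolean algebras, in the relational language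
    whose k-ary symbols say exactly which of the 2^k Boolean combinations of k
    elements are nonzero.  It eliminates quantifiers, and it has TP2 through
    the formula [x /\ y_i = z_ij] with the [y_i] disjoint.

    Chain condition: let [phi(x, a)] not fork over [A].  Some complete type
    [theta(x, a)] implying [phi] does not divide.  View tuples as functions on
    the Stone space, and call [s] allowed at an ultrafilter [h] if
    [theta] allows the value [s] of [x] at all ultrafilters with the same trace
    on [A] as [h].  If no value is allowed at some [h], or if some value taken
    according to [theta] on a part of [a] is allowed nowhere on that part,
    then suitable conjugates of [a] over [A] show that [theta] divides.
    Otherwise "[x] takes all allowed values everywhere" defines a global
    [A]-invariant type containing [theta]; by invariance it contains
    [phi(x, a')] for every conjugate [a'] of [a], and no dividing formula. *)

Set Implicit Arguments.
Unset Strict Implicit.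
Unset Printing Implicit Defensive.

Local Open Scope classical_set_scope.
Local Open Scope card_scope.

(** * Cardinality, inductive choice and compactness *)

Definition joint (X Y U : Type) (c : X -> U) (b : Y -> U) (z : X + Y) : U :=
  match z with inl x => c x | inr y => b y end.

Lemma card_eq_range (T : Type) (D : set T) k :
  D #= `I_k -> exists2 w : 'I_k -> T, injective w & D = range w.
Proof.
move=> /card_esym Dk.
have : [set: 'I_k] #= D by rewrite -(card_eql card_II).
move=> /card_bijP[f [g fK gK]].
exists (fun i => set_val (f (exist _ i (in_setT i)))).
  by move=> i j /val_inj/(can_inj fK)[].
apply/seteqP; split=> [x Dx|_ [i _ <-]]; last first.
  by case: (f _) => y Dy /=; exact: set_mem Dy.
exists (set_val (g (exist _ x (mem_set Dx)))) => //.
rewrite (_ : exist _ _ _ = g (exist _ x (mem_set Dx))) ?gK //.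
by case: (g _) => i iT; congr exist; exact: bool_irrelevance.
Qed.

Lemma finite_set_range (T : Type) (D : set T) :
  finite_set D -> exists k (w : 'I_k -> T), D = range w.
Proof. by case=> k /card_eq_range[w _ ->]; exists k, w. Qed.

Lemma finite_range_ord (T : Type) k (w : 'I_k -> T) : finite_set (range w).
Proof. exact/finite_image/finite_finset. Qed.

Lemma card_le_inj (T K : Type) (A : set T) (f : T -> K) :
  {in A &, injective f} -> A #<= [set: K].
Proof.
move=> /inj_card_eq/card_esym fA.
by rewrite (card_le_eql fA); exact: card_leT.
Qed.

Lemma card_leT_inj (T K : Type) (A : set T) :
  A #<= [set: K] -> exists f : A -> K, injective f.
Proof.
move=> /card_leP/unsquash g.
exists (fun x => set_val (g x)) => x y /val_inj.
by apply: inj; rewrite in_setT.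
Qed.

(** Hilbert's hotel: shifting a copy of [nat] inside [K] frees the value [g 0] for the new
    element. *)
Lemma card_leU1 (T K : Type) (A : set T) (x : T) :
  [set: nat] #<= [set: K] -> A #<= [set: K] -> x |` A #<= [set: K].
Proof.
move=> /card_leT_inj[g0 g0I] /card_leT_inj[f fI].
pose g n := g0 (exist _ n (mem_setT n)).
have gI : injective g by move=> i j /g0I[].
have [Ax|nAx] := pselect (A x).
  rewrite setUidr => [|_ ->//].
  apply: card_le_trans (_ : [set: A] #<= _).
    by rewrite (card_le_eqr (card_setT A)).
  by apply: (@card_le_inj _ _ _ f) => y z _ _ /fI.
pose sh k := if pselect (exists n, k = g n) is left P then g (sval (cid P)).+1 else k.
have shg n : sh (g n) = g n.+1.
  rewrite /sh; case: pselect => [P|[]]; last by exists n.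
  by case: cid => m /= /gI ->.
have shn k : ~ (exists n, k = g n) -> sh k = k by rewrite /sh; case: pselect.
have shI : injective sh.
  move=> k l; have [[i ->]|nk] := pselect (exists n, k = g n);
    have [[j ->]|nl] := pselect (exists n, l = g n).
  - by rewrite !shg => /gI[->].
  - by rewrite shg shn // => e; case: nl; exists i.+1.
  - by rewrite shg shn // => e; case: nk; exists j.+1.
  - by rewrite !shn.
have sh0 k : sh k <> g 0.
  have [[i ->]|nk] := pselect (exists n, k = g n); first by rewrite shg => /gI.
  by rewrite shn // => e; case: nk; exists 0.
pose h y := if pselect (A y) is left P then sh (f (exist _ y (mem_set P))) else g 0.
apply: (@card_le_inj _ _ _ h) => y z; rewrite !inE /h.
case: pselect => [Ay|nAy] yA; case: pselect => [Az|nAz] zA //.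
- by move=> /shI/fI[].
- by move=> /sh0.
- by move=> /esym/sh0.
- by case: yA zA => // -> [].
Qed.

Lemma card_leU_finite (T K : Type) (A D : set T) :
  [set: nat] #<= [set: K] -> finite_set D -> A #<= [set: K] ->
  A `|` D #<= [set: K].
Proof.
move=> natK /finite_set_range[k [w ->]] AK.
elim: k w => [|k IH] w.
  rewrite (_ : range w = set0) ?setU0 //.
  by apply/seteqP; split => // x [[]].
rewrite (_ : A `|` _ = w ord0 |` (A `|` range (fun i => w (lift ord0 i)))).
  exact: card_leU1.
apply/seteqP; split=> x.
  move=> [Ax|[i _ <-]]; first by right; left.
  by case: (unliftP ord0 i) => [j ->|->]; [right; right; exists j|left].
by move=> [->|[Ax|[j _ <-]]]; [right; exists ord0|left|right; exists (lift ord0 j)].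
Qed.

(** Dependent choice in which a new term sees only the finite set of its predecessors. [good] is the
    invariant carried along, [step] the relation of a term to that set. The sequences witnessing
    dividing are built this way. *)
Lemma dependent_sequence (X : Type) (good : set X -> Prop) (step : set X -> X -> Prop) :
  good set0 ->
  (forall S, finite_set S -> good S -> exists x, step S x /\ good (S `|` [set x])) ->
  exists u : nat -> X, forall j, good (u @` `I_j) /\ step (u @` `I_j) (u j).
Proof.
move=> good0 next.
have [y _] := next _ (finite_set0 X) good0.
have /boolp.choice[nx nxP] S : exists x, finite_set S -> good S ->
    step S x /\ good (S `|` [set x]).
  have [[fS gS]|nS] := pselect (finite_set S /\ good S).
    by have [x xP] := next _ fS gS; exists x.
  by exists y => fS gS; case: nS.
pose S := fix S j := if j is j'.+1 then S j' `|` [set nx (S j')] else set0.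
exists (fun j => nx (S j)).
have SE j : (fun j => nx (S j)) @` `I_j = S j.
  elim: j => [|j IH] /=; first by rewrite II0 image_set0.
  by rewrite IIS image_setU IH image_set1.
have fS j : finite_set (S j).
  by elim: j => [|j IH] /=; [exact: finite_set0|rewrite finite_setU; split].
have gS j : good (S j).
  by elim: j => [//|j IH] /=; have [] := nxP _ (fS j) IH.
by move=> j; rewrite SE; split => //; have [] := nxP _ (fS j) (gS j).
Qed.

(** Compactness of the cube: [h] is the pointwise limit of an ultrafilter containing the directed
    family, hence lies in the closure of every [S i]. *)
Lemma cube_compact (X I : Type) (S : I -> set (X -> bool)) :
  inhabited I -> (forall i, S i !=set0) ->
  (forall i j, exists k, S k `<=` S i `&` S j) ->
  exists h : X -> bool, forall D, finite_set D ->
    forall i, exists2 h', S i h' & forall x, D x -> h' x = h x.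
Proof.
move=> [i0] S0 Sdir.
pose F : set_system (X -> bool) := [set P | exists i, S i `<=` P].
have PF : ProperFilter F.
  apply: Build_ProperFilter_ex => /=.
    by move=> P [i SP]; have [h /SP] := S0 i; exists h.
  split.
  - by exists i0.
  - move=> P Q [i SP] [j SQ]; have [k Sk] := Sdir i j.
    by exists k => h /Sk[/SP Ph /SQ].
  - by move=> P Q PQ [i SP]; exists i; apply: subset_trans PQ.
have [U [UU FU]] := ultraFilterLemma PF.
have UF : Filter U by apply: filter_filter.
pose h x := `[< U [set h' : X -> bool | h' x] >].
have Uh x : U [set h' : X -> bool | h' x = h x].
  rewrite /h; case: asboolP => [//|nU].
  have [//|UC] := in_ultra_setVsetC [set h' : X -> bool | h' x] UU.
  by apply: (filterS _ UC) => h' /= /negP/negbTE.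
exists h => D /finite_set_range[k [w ->]] i.
have UD : U [set h' : X -> bool | forall j : 'I_k, h' (w j) = h (w j)].
  by apply: filter_forall => j; exact: Uh.
have USi : U (S i) by apply: FU; exists i.
have [h' [Sh' h'h]] := @filter_ex _ U _ _ (@filterI _ U UF _ _ USi UD).
by exists h' => // _ [j _ <-].
Qed.

(** * Renaming and universal closure *)

Fixpoint tren (L : language) (V W : Type) (g : V -> W) (t : term L V) : term L W :=
  match t with
  | Var x => Var L (g x)
  | App f ts => App (fun i => tren g (ts i))
  end.

Fixpoint fren (L : language) (V W : Type) (g : V -> W) (phi : formula L V) :
    formula L W :=
  match phi with
  | Bot => Bot
  | Eq s t => Eq (tren g s) (tren g t)
  | Rel r ts => Rel (fun i => tren g (ts i))
  | Imp p q => Imp (fren g p) (fren g q)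
  | All p => All (fren (omap g) p)
  end.

Lemma eval_tren (L : language) (M : structure L) (V W : Type) (g : V -> W)
    (t : term L V) (v : W -> M) : eval v (tren g t) = eval (v \o g) t.
Proof. by elim: t => //= f ts IH; congr fint; apply/funext. Qed.

Lemma holds_fren (L : language) (M : structure L) (V W : Type) (g : V -> W)
    (phi : formula L V) (v : W -> M) :
  holds (fren g phi) v <-> holds phi (v \o g).
Proof.
elim: phi W g v => {V} [V|V s t|V r ts|V p IHp q IHq|V p IHp] W g v //=.
- by rewrite !eval_tren.
- by rewrite (_ : (fun i => _) = (fun i => eval (v \o g) (ts i))) //;
    apply/funext => i; rewrite eval_tren.
- by rewrite IHp IHq.
- have E x : extend v x \o omap g = extend (v \o g) x by apply/funext; case.
  by split=> H x; have := H x; rewrite IHp E.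
Qed.

(** Induction on [n]: the variable [ord0] of the block becomes the variable [None] bound by [All],
    and the others form a shorter block. *)
Lemma all_block (L : language) n (V : Type) (phi : formula L (V + 'I_n)) :
  exists psi : formula L V, forall (M : structure L) (v : V -> M),
    holds psi v <-> forall y : 'I_n -> M, holds phi (joint v y).
Proof.
elim: n V phi => [|n IH] V phi.
  pose g (z : V + 'I_0) :=
    match z with inl x => x | inr i => False_rect V (notF (ltn_ord i)) end.
  exists (fren g phi) => M v; rewrite holds_fren.
  have E y : v \o g = joint v y by apply/funext; case=> // -[].
  split=> [H y|H]; first by rewrite -E.
  by rewrite (E (fun i => False_rect M (notF (ltn_ord i)))).
pose g (z : V + 'I_n.+1) : option V + 'I_n :=
  match z with
  | inl x => inl (Some x)
  | inr i => if unlift ord0 i is Some j then inr j else inl None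
  end.
have [psi psiP] := IH _ (fren g phi).
exists (All psi) => M v /=; split=> [H y|H x].
  have /psiP/(_ (fun j => y (lift ord0 j))) := H (y ord0).
  rewrite holds_fren; congr holds; apply/funext => -[z//|i] /=.
  by case: (unliftP ord0 i) => [j ->|->] //=.
apply/psiP => y; rewrite holds_fren.
pose y' i := if unlift ord0 i is Some j then y j else x.
suff -> : joint (extend v x) y \o g = joint v y' by [].
by apply/funext => -[z//|i] /=; rewrite /y'; case: (unlift ord0 i).
Qed.

Lemma universal_closure (L : language) k (phi : formula L 'I_k) :
  exists s : sentence L, forall M : structure L,
    holds s (of_void M) <-> forall v : 'I_k -> M, holds phi v.
Proof.
have [s sP] := all_block (fren (@inr void 'I_k) phi).
exists s => M; rewrite sP.
have E v : joint (of_void M) v \o inr = v by [].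
by split=> H v; have := H v; rewrite holds_fren E.
Qed.

Definition theory (L : language) (M : structure L) : set (sentence L) :=
  [set s | holds s (of_void M)].

Lemma models_theory (L : language) (M0 M : structure L) k (phi : formula L 'I_k) :
  models (theory M0) M -> (forall v : 'I_k -> M0, holds phi v) ->
  forall v : 'I_k -> M, holds phi v.
Proof.
by move=> TM H; have [s sP] := universal_closure phi; apply/sP/TM/sP.
Qed.

Lemma complete_theory (L : language) (M : structure L) : complete (theory M).
Proof.
split; first by exists M.
move=> s; have [Ms|nMs] := pselect (holds s (of_void M)); [left|right];
  by move=> N; apply.
Qed.

(** * Pattern algebras and their points *)

(** A function [f] in [Z] stands for the meet of the elements with [f i] true and the complements of
    the others; [Z] lists the nonzero meets. *)
Definition pattern_language : language :=
  @Language void (fun f => match f with end)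
    {k : nat & {set {ffun 'I_k -> bool}}} (fun r => tag r).

Definition pat (M : structure pattern_language) k (Z : {set {ffun 'I_k -> bool}})
    (v : 'I_k -> M) : Prop :=
  rint (r := existT _ k Z : rsym pattern_language) v.

Definition atom (V : Type) k (Z : {set {ffun 'I_k -> bool}}) (w : 'I_k -> V) :
    formula pattern_language V :=
  Rel (r := existT _ k Z : rsym pattern_language) (fun i => Var pattern_language (w i)).

Lemma holds_atom (M : structure pattern_language) (V : Type) k
    (Z : {set {ffun 'I_k -> bool}}) (w : 'I_k -> V) (v : V -> M) :
  holds (atom Z w) v <-> pat Z (v \o w).
Proof. by []. Qed.

Definition cat_fun (T : Type) k n (v : 'I_k -> T) (w : 'I_n -> T) (i : 'I_(k + n)) : T :=
  joint v w (fintype.split i).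

Lemma cat_fun_lshift (T : Type) k n (v : 'I_k -> T) (w : 'I_n -> T) i :
  cat_fun v w (lshift n i) = v i.
Proof. by rewrite /cat_fun -[lshift n i]/(unsplit (inl i)) unsplitK. Qed.

Lemma cat_fun_rshift (T : Type) k n (v : 'I_k -> T) (w : 'I_n -> T) i :
  cat_fun v w (rshift k i) = w i.
Proof. by rewrite /cat_fun -[rshift k i]/(unsplit (inr i)) unsplitK. Qed.

Lemma comp_cat_fun (T U : Type) (f : T -> U) k n (v : 'I_k -> T) (w : 'I_n -> T) :
  f \o cat_fun v w = cat_fun (f \o v) (f \o w).
Proof. by apply/funext => i; rewrite /cat_fun /=; case: (fintype.split i). Qed.

Definition pair_fun (T : Type) (x y : T) (i : 'I_2) : T := if i == ord0 then x else y.

(** Axioms read off from atomless Boolean algebras. [pat_ext] carries atomlessness: it realizes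
    every pattern on [k + n] elements that restricts to the pattern of [v], even one that splits
    each nonzero meet. *)
Record pattern_algebra (M : structure pattern_language) : Prop := PatternAlgebra {
  pat_ex : forall k (v : 'I_k -> M), exists Z, pat Z v;
  pat_uniq : forall k (v : 'I_k -> M) Z Z', pat Z v -> pat Z' v -> Z = Z';
  pat_map : forall k l (g : 'I_l -> 'I_k) Z (v : 'I_k -> M), pat Z v ->
    pat [set [ffun i => (f : {ffun 'I_k -> bool}) (g i)] | f in Z]%SET (v \o g);
  pat_ext : forall k n (W : {set {ffun 'I_(k + n) -> bool}}) (v : 'I_k -> M),
    pat [set [ffun i => (f : {ffun 'I_(k + n) -> bool}) (lshift n i)] | f in W]%SET v ->
    exists y : 'I_n -> M, pat W (cat_fun v y);
  pat_eq : forall (Z : {set {ffun 'I_2 -> bool}}) (x y : M),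
    (forall f : {ffun 'I_2 -> bool}, f \in Z -> f ord0 = f ord_max) ->
    pat Z (pair_fun x y) -> x = y }.

(** The [foldr] expresses a finite disjunction by [Imp] and [Bot] alone. *)
Lemma holds_exists_seq (L : language) (M : structure L) (V : Type) (I : eqType)
    (phi : I -> formula L V) (s : seq I) (v : V -> M) :
  holds (foldr (fun i psi => Imp (Not (phi i)) psi) Bot s) v <->
  exists2 i, i \in s & holds (phi i) v.
Proof.
elim: s => [|i s IH] /=; first by split=> [//|[]].
rewrite IH; split=> [H|[j]].
  have [Hi|nHi] := pselect (holds (phi i) v); first by exists i; rewrite // mem_head.
  by have [j js Hj] := H nHi; exists j; rewrite // in_cons js orbT.
by rewrite in_cons => /orP[/eqP->|js] Hj nH; [case: nH|exists j].
Qed.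

(** For fixed arities and patterns each axiom is the universal closure of one formula, so it passes
    between models of the same theory. The choice of [Z] is a finite disjunction, the choice of [y]
    a negated block of quantifiers. *)
Lemma pattern_algebra_models (M0 M : structure pattern_language) :
  pattern_algebra M0 -> models (theory M0) M -> pattern_algebra M.
Proof.
move=> PA TM; split.
- move=> k v.
  pose phi Z : formula pattern_language 'I_k := atom Z id.
  have H : holds (foldr (fun i psi => Imp (Not (phi i)) psi) Bot
     (enum {set {ffun 'I_k -> bool}})) v.
    apply: (models_theory TM) => v0; apply/holds_exists_seq.
    by have [Z Zv] := pat_ex PA v0; exists Z; rewrite ?mem_enum.
  by have /holds_exists_seq[Z _ Zv] := H; exists Z.
- move=> k v Z Z'.
  have [//|/eqP ZZ'] := eqVneq Z Z'.
  pose phi : formula pattern_language 'I_k := Imp (atom Z id) (Not (atom Z' id)).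
  have H : holds phi v.
    apply: (models_theory TM) => v0 /= Zv Z'v.
    exact: ZZ' (pat_uniq PA Zv Z'v).
  by move=> Zv Z'v; case: (H Zv Z'v).
- move=> k l g Z v.
  pose phi : formula pattern_language 'I_k := Imp (atom Z id)
    (atom [set [ffun i => (f : {ffun 'I_k -> bool}) (g i)] | f in Z]%SET g).
  have H : holds phi v.
    by apply: (models_theory TM) => v0 /= Zv; exact: pat_map.
  exact: H.
- move=> k n W v.
  pose psi : formula pattern_language ('I_k + 'I_n) :=
    Not (atom W (fun i => fintype.split i)).
  have [all_psi all_psiP] := all_block psi.
  pose phi : formula pattern_language 'I_k := Imp (atom [set [ffun i =>
    (f : {ffun 'I_(k + n) -> bool}) (lshift n i)] | f in W]%SET id) (Not all_psi).
  have H : holds phi v.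
    apply: (models_theory TM) => v0 /= Wv /all_psiP H.
    by have [y] := pat_ext PA Wv; exact: H.
  move=> Wv; apply: contrapT => nW; apply: (H Wv).
  by apply/all_psiP => y Wy; apply: nW; exists y.
- move=> Z x y Zd.
  pose phi : formula pattern_language 'I_2 := Imp (atom Z id)
    (Eq (Var pattern_language ord0) (Var pattern_language ord_max)).
  have H : holds phi (pair_fun x y).
    apply: (models_theory TM) => v0 /= Zv; apply: (pat_eq PA Zd).
    rewrite (_ : pair_fun _ _ = v0) //; apply/funext => i.
    rewrite /pair_fun; case: eqP => [->//|/eqP i0]; congr v0.
    by apply/val_inj; case: i i0 => -[|[|]].
  exact: H.
Qed.

Section Points.
Variables (M : structure pattern_language) (PA : pattern_algebra M).

(** Points are the ultrafilters of the Boolean algebra [M]. *)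
Definition is_point (h : M -> bool) : Prop :=
  forall k (v : 'I_k -> M) Z, pat Z v -> [ffun i => h (v i)] \in Z.

(** Sending the index [j] to [i] does not change the tuple, so by uniqueness [Z] is its own image
    under this map, and functions in the image agree at [i] and [j]. *)
Lemma pat_respects k (u : 'I_k -> M) Z (f : {ffun 'I_k -> bool}) i j :
  pat Z u -> f \in Z -> u i = u j -> f i = f j.
Proof.
move=> Zu fZ uij; pose g l := if l == j then i else l.
have ug : u \o g = u.
  by apply/funext => l; rewrite /g /=; case: eqP => // ->.
have := pat_map PA g Zu; rewrite ug => /(pat_uniq PA Zu) ZE.
move: fZ; rewrite ZE => /imsetP[f' _ ->]; rewrite !ffunE /g eqxx.
by case: eqP.
Qed.

Lemma pat_lshift k n (v : 'I_k -> M) (w : 'I_n -> M) Z W :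
  pat Z v -> pat W (cat_fun v w) ->
  Z = [set [ffun i => (f : {ffun 'I_(k + n) -> bool}) (lshift n i)] | f in W]%SET.
Proof.
move=> Zv /(pat_map PA (@lshift k n)) Wv; apply: (pat_uniq PA Zv).
by move: Wv; congr pat; apply/funext => i /=; rewrite cat_fun_lshift.
Qed.

Lemma pat_rshift k n (v : 'I_k -> M) (w : 'I_n -> M) Z W :
  pat Z w -> pat W (cat_fun v w) ->
  Z = [set [ffun i => (f : {ffun 'I_(k + n) -> bool}) (rshift k i)] | f in W]%SET.
Proof.
move=> Zw /(pat_map PA (@rshift k n)) Ww; apply: (pat_uniq PA Zw).
by move: Ww; congr pat; apply/funext => i /=; rewrite cat_fun_rshift.
Qed.

(** The ultrafilter theorem: for each finite tuple [w], [f] extends to a member of the pattern of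
    [v] followed by [w], and compactness glues these extensions. *)
Lemma point_of_pat k (v : 'I_k -> M) Z (f : {ffun 'I_k -> bool}) :
  pat Z v -> f \in Z -> exists2 h, is_point h & forall i, h (v i) = f i.
Proof.
move=> Zv fZ.
pose I := {n : nat & 'I_n -> M}.
pose S (iw : I) : set (M -> bool) := [set h | (forall i, h (v i) = f i) /\
  forall Z', pat Z' (tagged iw) -> [ffun i => h (tagged iw i)] \in Z'].
have [|||h hS] := @cube_compact M I S.
- exact: (inhabits (existT _ k v)).
- move=> [n w].
  have [W Wu] := pat_ex PA (cat_fun v w).
  move: fZ; rewrite (pat_lshift Zv Wu) => /imsetP[F FW fE].
  (* [F] becomes a function on [M], false off the tuple; [pat_respects] makes the choice of index
     harmless. *)
  pose h x := if pselect (exists i, cat_fun v w i = x) is left P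
              then F (sval (cid P)) else false.
  have hF i : h (cat_fun v w i) = F i.
    rewrite /h; case: pselect => [P|[]]; last by exists i.
    by case: cid => j /= /(pat_respects Wu FW).
  exists h; split=> [i|Z' /= Z'w].
    by rewrite -(cat_fun_lshift v w) hF fE ffunE.
  rewrite (pat_rshift Z'w Wu); apply/imsetP; exists F => //.
  by apply/ffunP => i; rewrite !ffunE -hF cat_fun_rshift.
- move=> [n w] [l w']; exists (existT _ (n + l) (cat_fun w w')) => h [/= hv hW].
  have [W Wu] := pat_ex PA (cat_fun w w').
  split; split => //= Z' Z'w; [rewrite (pat_lshift Z'w Wu)|rewrite (pat_rshift Z'w Wu)];
    apply/imsetP; exists [ffun i => h (cat_fun w w' i)]; rewrite ?hW //;
    by apply/ffunP => i; rewrite !ffunE ?cat_fun_lshift ?cat_fun_rshift.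
exists h => [n w Z' Z'w|i].
  have [h' [_ /= h'Z'] h'h] := hS _ (finite_range_ord w) (existT _ n w).
  rewrite (_ : [ffun i => h (w i)] = [ffun i => h' (w i)]) ?h'Z' //.
  by apply/ffunP => i; rewrite !ffunE h'h //; exists i.
have [h' [/= h'v _] h'h] := hS _ (finite_range_ord v) (existT _ k v).
by rewrite -h'v h'h //; exists i.
Qed.

(** Stone duality: from here on patterns are handled through the values of tuples at points. *)
Lemma patP k (v : 'I_k -> M) Z :
  pat Z v <-> forall f : {ffun 'I_k -> bool},
    f \in Z <-> exists2 h, is_point h & forall i, h (v i) = f i.
Proof.
have dir Z' : pat Z' v -> forall f : {ffun 'I_k -> bool},
    f \in Z' <-> exists2 h, is_point h & forall i, h (v i) = f i.
  move=> Z'v f; split=> [|[h hP hf]]; first exact: point_of_pat.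
  rewrite (_ : f = [ffun i => h (v i)]); first exact: hP.
  by apply/ffunP => i; rewrite ffunE.
split=> [/dir//|H]; have [Z' Z'v] := pat_ex PA v.
suff -> : Z = Z' by [].
by apply/setP => f; apply/idP/idP => [/H/(dir _ Z'v f).2|/(dir _ Z'v f).1/H].
Qed.

Lemma point_separates (x y : M) : (forall h, is_point h -> h x = h y) -> x = y.
Proof.
move=> H; have [Z Zxy] := pat_ex PA (pair_fun x y).
apply: (pat_eq PA _ Zxy) => f /((patP _ _).1 Zxy)[h hP hf].
by rewrite -!hf; exact: H.
Qed.

(** This is atomlessness. *)
Lemma realize_over_finite (D : set M) n (Psi : (M -> bool) -> ('I_n -> bool) -> Prop) :
  finite_set D -> (forall h, is_point h -> exists f, Psi h f) ->
  exists x : 'I_n -> M,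
    (forall h, is_point h -> exists h', [/\ is_point h', forall z, D z -> h' z = h z
        & Psi h' (h \o x)]) /\
    (forall h f, is_point h -> Psi h f -> exists h', [/\ is_point h',
        forall z, D z -> h' z = h z & h' \o x = f]).
Proof.
move=> /finite_set_range[k [w ->]] tot.
(* [W] sees a point only through its trace on [w], so [x] can follow [Psi] only up to a change of
   point that keeps this trace. *)
pose W : {set {ffun 'I_(k + n) -> bool}} := [set F | `[< exists h f,
  [/\ is_point h, Psi h f & F = finfun (cat_fun (h \o w) f)] >]]%SET.
have WP (F : {ffun 'I_(k + n) -> bool}) : F \in W <-> exists h f,
  [/\ is_point h, Psi h f & F = finfun (cat_fun (h \o w) f)].
  by rewrite inE; split => /asboolP.
have [|x Wx] := @pat_ext _ PA k n W w.
  apply/patP => f; split.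
    move=> /imsetP[F /WP[h [s [hP _ ->]] ->]]; exists h => // i.
    by rewrite !ffunE cat_fun_lshift.
  move=> [h hP hf]; have [s hs] := tot _ hP.
  apply/imsetP; exists (finfun (cat_fun (h \o w) s)); first by apply/WP; exists h, s.
  by apply/ffunP => i; rewrite !ffunE cat_fun_lshift -hf.
have {}Wx := (patP _ _).1 Wx.
exists x; split=> [h hP|h f hP hf].
  have /WP[h' [f [h'P h'f E]]] : [ffun i => h (cat_fun w x i)] \in W.
    by apply/Wx; exists h => // i; rewrite ffunE.
  exists h'; split=> // [_ [i _ <-]|].
    by have /ffunP/(_ (lshift n i)) := E; rewrite !ffunE !cat_fun_lshift.
  rewrite (_ : h \o x = f) //; apply/funext => i.
  by have /ffunP/(_ (rshift k i)) := E; rewrite !ffunE !cat_fun_rshift.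
have /Wx[h' h'P h'E] : finfun (cat_fun (h \o w) f) \in W by apply/WP; exists h, f.
exists h'; split=> // [_ [i _ <-]|].
  by have := h'E (lshift n i); rewrite !ffunE !cat_fun_lshift.
by apply/funext => i; have := h'E (rshift k i); rewrite !ffunE !cat_fun_rshift.
Qed.

(** The points form a closed subset of the cube, so prescribed values on [D] need only be checked on
    finite parts. *)
Lemma point_compact (D : set M) m (w : 'I_m -> M) (g : M -> bool) (f : 'I_m -> bool) :
  (forall D0, finite_set D0 -> D0 `<=` D ->
    exists h, [/\ is_point h, forall z, D0 z -> h z = g z & h \o w = f]) ->
  exists h, [/\ is_point h, forall z, D z -> h z = g z & h \o w = f].
Proof.
move=> H.
pose I := {D0 : set M | finite_set D0 /\ D0 `<=` D}.
pose S (i : I) : set (M -> bool) :=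
  [set h | [/\ is_point h, forall z, sval i z -> h z = g z & h \o w = f]].
have [|||h hS] := @cube_compact M I S.
- by apply: inhabits; exists set0; split; [exact: finite_set0|].
- by case=> D0 [fD0 D0D]; have [h hP] := H _ fD0 D0D; exists h.
- move=> [D1 [fD1 D1D]] [D2 [fD2 D2D]].
  have D12 : finite_set (D1 `|` D2) /\ D1 `|` D2 `<=` D.
    by rewrite finite_setU; do !split => //; move=> x [/D1D|/D2D].
  exists (exist _ (D1 `|` D2) D12 : I) => h [hP /= hg hw].
  by split; split => //= z Dz; apply: hg; [left|right].
have i0 : I by exists set0; split; [exact: finite_set0|].
exists h; split.
- move=> k v Z Zv; have [h' [h'P _ _] h'h] := hS _ (finite_range_ord v) i0.
  rewrite (_ : [ffun i => h (v i)] = [ffun i => h' (v i)]); first exact: h'P.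
  by apply/ffunP => i; rewrite !ffunE h'h //; exists i.
- move=> z Dz.
  have Dz1 : finite_set [set z] /\ [set z] `<=` D.
    by split=> [|_ ->//]; exact: finite_set1.
  have [h' [_ /= h'g _] h'h] := hS _ (finite_set1 z) (exist _ [set z] Dz1 : I).
  by rewrite -h'h // h'g.
- have [h' [_ _ <-] h'h] := hS _ (finite_range_ord w) i0.
  by apply/funext => i /=; rewrite h'h //; exists i.
Qed.

(** * Quantifier elimination by back-and-forth *)

Definition covers (V : Type) (D : set V) (v v' : V -> M) : Prop :=
  forall h, is_point h -> exists2 h', is_point h' & forall z, D z -> h' (v' z) = h (v z).

Lemma coversS (V : Type) (D D' : set V) (v v' : V -> M) :
  D `<=` D' -> covers D' v v' -> covers D v v'.
Proof.
by move=> DD' H h /H[h' h'P h'h]; exists h' => // z /DD'; exact: h'h.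
Qed.

(** The extension step: over a trace on [v], the element [x] is made to take exactly the values that
    [x'] takes over the same trace on [v']. *)
Lemma covers_extend (V : Type) (D : set V) (v v' : V -> M) (x' : M) :
  finite_set D -> covers D v v' -> covers D v' v ->
  exists x, let D' := [set o | if o is Some z then D z else True] in
    covers D' (extend v x) (extend v' x') /\ covers D' (extend v' x') (extend v x).
Proof.
move=> fD vv' v'v.
pose Psi h (f : 'I_1 -> bool) := exists h', [/\ is_point h',
  forall z, D z -> h' (v' z) = h (v z) & h' x' = f ord0].
have [||x [x1 x2]] := @realize_over_finite (v @` D) 1 Psi.
- exact: finite_image.
- by move=> h /vv'[h' h'P h'h]; exists (fun=> h' x'); exists h'.
exists (x ord0); split=> h hP.
  have [h1 [h1P h1h [h' [h'P h'h1 h'x]]]] := x1 _ hP.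
  exists h' => //; case=> [z Dz|_] //=.
  by rewrite h'h1 // h1h //; exists z.
have [h' h'P h'h] := v'v _ hP.
have [|h1 [h1P h1h' h1x]] := x2 h' (fun=> h x') h'P.
  by exists h; split=> // z Dz; rewrite h'h.
exists h1 => //; case=> [z Dz|_] /=; first by rewrite h1h' ?h'h //; exists z.
by rewrite -[h1 _]/((h1 \o x) ord0) h1x.
Qed.

(** Quantifier elimination in semantic form. The finite set [D] of relevant variables is carried
    through the induction because [V] may be infinite, while [covers_extend] works over finite
    sets. *)
Lemma holds_covers (V : Type) (phi : formula pattern_language V) :
  exists2 D, finite_set D & forall v v' : V -> M,
    covers D v v' -> covers D v' v -> holds phi v -> holds phi v'.
Proof.
elim: phi => {V} [V|V [x|[]] [y|[]]|V [k Z] ts|V p [D1 fD1 IHp] q [D2 fD2 IHq]|V p [D fD IH]].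
- by exists set0; first exact: finite_set0.
- exists [set x; y]; first exact: finite_set2.
  move=> v v' _ v'v /= vxy; apply: point_separates => h /v'v[h' _ h'h].
  by rewrite -!h'h ?vxy; [|right|left].
- have [w tsE] : exists w, ts = fun i => Var pattern_language (w i).
    exists (fun i => match ts i with Var x => x | App f _ => match f with end end).
    by apply/funext => i; case: (ts i) => // -[].
  exists (range w); first exact: finite_range_ord.
  move=> v v' vv' v'v; rewrite tsE /= => /patP Zv.
  apply/patP => f; rewrite Zv; split=> [[h /vv'[h' h'P h'h] hf]|[h /v'v[h' h'P h'h] hf]];
    by exists h' => // i; rewrite h'h ?hf //; exists i.
- exists (D1 `|` D2); first by rewrite finite_setU.
  move=> v v' vv' v'v H pv'; apply: (IHq v); [exact: coversS vv'|exact: coversS v'v|].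
  by apply: H; apply: (IHp v') => //; [exact: coversS v'v|exact: coversS vv'].
- exists (Some @^-1` D).
    by apply: finite_preimage fD => x y _ _ [].
  move=> v v' vv' v'v H x'.
  have [|x [xx' x'x]] := covers_extend x' _ vv' v'v.
    by apply: finite_preimage fD => x y _ _ [].
  by apply: IH (H x); [apply: coversS xx'|apply: coversS x'x]; case.
Qed.

Lemma holds_coversT (V : Type) (phi : formula pattern_language V) (v v' : V -> M) :
  covers setT v v' -> covers setT v' v -> holds phi v -> holds phi v'.
Proof.
move=> vv' v'v; have [D _ H] := holds_covers phi.
by apply: H; [exact: coversS vv'|exact: coversS v'v].
Qed.

(** * Types over a set of parameters, and saturation *)

Section Types.
Variables (A : set M).

Definition eq_on (B : set M) (h h' : M -> bool) := forall z, B z -> h z = h' z.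

Definition covers_over (X : Type) (a b : X -> M) : Prop :=
  forall h, is_point h -> exists h', [/\ is_point h', eq_on A h' h & h' \o b = h \o a].

Lemma same_type_covers (X : Type) (a b : X -> M) :
  covers_over a b -> covers_over b a -> same_type A a b.
Proof.
have cov (c d : X -> M) : covers_over c d -> covers setT
    (joint c (@set_val M A)) (joint d (@set_val M A)).
  move=> cd h /cd[h' [h'P h'A h'E]]; exists h' => // -[x|[y Ay]] _ /=.
    by rewrite -[LHS]/((h' \o d) x) h'E.
  by apply: h'A; exact: set_mem Ay.
move=> ab ba phi; split => H.
  by apply: (@holds_coversT _ _ (joint a (@set_val M A))) H; exact: cov.
by apply: (@holds_coversT _ _ (joint b (@set_val M A))) H; exact: cov.
Qed.

(** Atomic formulas yield the required point for each finite part of [A]; [point_compact] passes to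
    all of [A]. *)
Lemma covers_same_type m (a b : 'I_m -> M) : same_type A a b -> covers_over a b.
Proof.
move=> ab h hP.
apply: point_compact => D0 /finite_set_range[k [w ->]] wA.
have wA' i : w i \in A by apply: mem_set; apply: wA; exists i.
have [Z Zwa] := pat_ex PA (cat_fun w a).
pose w' (i : 'I_k) : 'I_m + A := inr (exist _ (w i) (wA' i)).
pose phi : formula pattern_language ('I_m + A) := atom Z (cat_fun w' inl).
have E c : (fun z => match z with inl x => c x | inr y => @set_val M A y end) \o
    cat_fun w' inl = cat_fun w c.
  by rewrite comp_cat_fun.
have /ab : sol phi (@set_val M A) a by apply/holds_atom; rewrite E.
move=> /(holds_atom _ _ _).1; rewrite E => /patP Zwb.
have /Zwb[h' h'P h'h] : [ffun i => h (cat_fun w a i)] \in Z by exact: hP.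
exists h'; split=> // [_ [i _ <-]|].
  by have := h'h (lshift m i); rewrite ffunE !cat_fun_lshift.
by apply/funext => i; have := h'h (rshift k i); rewrite ffunE !cat_fun_rshift.
Qed.

End Types.

Lemma same_typeC (A : set M) (X : Type) (a b : X -> M) :
  same_type A a b -> same_type A b a.
Proof. by move=> ab phi; split => /ab. Qed.

(** [realize_over_finite] over a small set: the patterns prescribed by [Psi] over finite tuples of
    [A] form a type, finitely satisfiable by that lemma. The first clause concerns finite [D] only,
    since [Psi] is not assumed closed under limits. *)
Lemma saturated_realize (K : Type) (A : set M) m
    (Psi : (M -> bool) -> ('I_m -> bool) -> Prop) :
  saturated K M -> small K A ->
  (forall h, is_point h -> exists f, Psi h f) ->
  exists x : 'I_m -> M,
    (forall D, finite_set D -> D `<=` A -> forall h, is_point h ->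
       exists h', [/\ is_point h', eq_on D h' h & Psi h' (h \o x)]) /\
    (forall h f, is_point h -> Psi h f -> exists h', [/\ is_point h', eq_on A h' h & h' \o x = f]).
Proof.
move=> satM smA tot.
pose Zof k (w : 'I_k -> A) : {set {ffun 'I_(k + m) -> bool}} := [set F | `[< exists h f,
  [/\ is_point h, Psi h f & F = finfun (cat_fun (h \o set_val \o w) f)] >]]%SET.
have ZofP k w (F : {ffun 'I_(k + m) -> bool}) : F \in Zof k w <-> exists h f,
    [/\ is_point h, Psi h f & F = finfun (cat_fun (h \o set_val \o w) f)].
  by rewrite inE; split => /asboolP.
pose phi k (w : 'I_k -> A) : formula pattern_language ('I_m + A) :=
  atom (Zof k w) (cat_fun (inr \o w) inl).
pose p : set (formula pattern_language ('I_m + A)) :=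
  [set f | exists k (w : 'I_k -> A), f = phi k w].
have phiP k (w : 'I_k -> A) (x : 'I_m -> M) : sol (phi k w) (@set_val M A) x <->
    pat (Zof k w) (cat_fun (set_val \o w) x).
  have <- : joint x (@set_val M A) \o cat_fun (inr \o w) inl = cat_fun (set_val \o w) x.
    by rewrite comp_cat_fun.
  exact: holds_atom.
have [|x xp] := satM A smA m p.
  move=> J fJ Jp.
  (* [E f] collects the parameters named by a formula [f] in [J]; outside [J] it is empty by
     default. *)
  have /boolp.choice[E EP] f : exists E : set M, finite_set E /\ (J f ->
      exists k (w : 'I_k -> A), f = phi k w /\ E = range (set_val \o w)).
    have [/Jp[k [w ->]]|nJ] := pselect (J f).
      exists (range (set_val \o w)); split=> [|_]; first exact: finite_range_ord.
      by exists k, w.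
    by exists set0; split=> //; exact: finite_set0.
  have [|x [x1 x2]] := @realize_over_finite (\bigcup_(f in J) E f) m Psi _ tot.
    by apply: bigcup_finite => // f _; have [] := EP f.
  exists x => f Jf; have [_ /(_ Jf)[k [w [fE EE]]]] := EP f.
  rewrite fE phiP; apply/patP => F; rewrite ZofP.
  have inE i : (\bigcup_(f in J) E f) (set_val (w i)).
    by exists f => //; rewrite EE; exists i.
  split=> [[h [s [hP hs ->]]]|[h hP hF]].
    have [h' [h'P h'h <-]] := x2 _ _ hP hs; exists h' => // i.
    rewrite ffunE -[LHS]/((h' \o cat_fun _ _) i) comp_cat_fun; congr cat_fun.
    by apply/funext => j /=; exact: h'h.
  have [h' [h'P h'h h'x]] := x1 _ hP; exists h', (h \o x); split=> //.
  apply/ffunP => i; rewrite ffunE -hF -[LHS]/((h \o cat_fun _ _) i) comp_cat_fun.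
  by congr cat_fun; apply/funext => j /=; rewrite h'h.
have {}xp k (w : 'I_k -> A) : pat (Zof k w) (cat_fun (set_val \o w) x).
  by apply/phiP/xp; exists k, w.
have sub D : finite_set D -> D `<=` A -> exists k (w : 'I_k -> A), D = range (set_val \o w).
  move=> /finite_set_range[k [w ->]] wA.
  have wA' i : w i \in A by apply: mem_set; apply: wA; exists i.
  by exists k, (fun i => exist _ (w i) (wA' i)).
exists x; split=> [D fD DA h hP|h f hP hf].
  have [k [w ->]] := sub D fD DA.
  have /patP/(_ [ffun i => h (cat_fun (set_val \o w) x i)])[_ inZ] := xp k w.
  have /ZofP[h' [f [h'P h'f E]]] : [ffun i => h (cat_fun (set_val \o w) x i)] \in Zof k w.
    by apply: inZ; exists h => // i; rewrite ffunE.
  exists h'; split=> // [_ [i _ <-]|].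
    by have /ffunP/(_ (lshift m i)) := E; rewrite !ffunE !cat_fun_lshift.
  rewrite (_ : h \o x = f) //; apply/funext => i.
  by have /ffunP/(_ (rshift k i)) := E; rewrite !ffunE !cat_fun_rshift.
apply: point_compact => D fD DA; have [k [w ->]] := sub D fD DA.
have /patP/(_ (finfun (cat_fun (h \o set_val \o w) f)))[+ _] := xp k w.
case; first by apply/ZofP; exists h, f.
move=> h' h'P h'E; exists h'; split=> // [_ [i _ <-]|].
  by have := h'E (lshift m i); rewrite !ffunE !cat_fun_lshift.
by apply/funext => i; have := h'E (rshift k i); rewrite !ffunE !cat_fun_rshift.
Qed.

End Points.

(** * Forking in pattern algebras *)

Lemma eq_on_trans (M : structure pattern_language) (B C : set M) (h1 h2 h3 : M -> bool) :
  C `<=` B -> eq_on B h1 h2 -> eq_on C h2 h3 -> eq_on C h1 h3.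
Proof. by move=> CB h12 h23 z Cz; rewrite h12 ?h23 //; exact: CB. Qed.

Section ChainCondition.
Variables (M : structure pattern_language) (PA : pattern_algebra M).
Variables (K : Type) (natK : [set: nat] #<= [set: K]) (satM : saturated K M).
Variables (A : set M) (smA : small K A).

Section Conjugates.
Variables (m : nat) (a : 'I_m -> M).

(** The type of [a] over [A], seen as a relation between traces on [A] and values of [a]. *)
Definition type_at (h : M -> bool) (f : 'I_m -> bool) : Prop :=
  exists h', [/\ is_point h', eq_on A h' h & h' \o a = f].

Definition with_tuples (S : set ('I_m -> M)) : set M := A `|` \bigcup_(b in S) range b.

(** [Psi] prescribes the type of [b] over [A] and the tuples in [S]. It allows only values from the
    type of [a], and allows each value of [a] somewhere in the same fibre over [A]; these two
    conditions give the two halves of [same_type A b a]. *)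
Lemma saturated_conjugate (S : set ('I_m -> M))
    (Psi : (M -> bool) -> ('I_m -> bool) -> Prop) :
  finite_set S ->
  (forall h, is_point h -> exists f, Psi h f) ->
  (forall h f, is_point h -> Psi h f -> type_at h f) ->
  (forall h, is_point h -> exists h', [/\ is_point h', eq_on A h' h & Psi h' (h \o a)]) ->
  exists b : 'I_m -> M, [/\ same_type A b a,
    forall c h, S c -> is_point h ->
       exists h', [/\ is_point h', h' \o c = h \o c & Psi h' (h \o b)] &
    forall h f, is_point h -> Psi h f ->
       exists h', [/\ is_point h', eq_on (with_tuples S) h' h & h' \o b = f]].
Proof.
move=> fS tot Psicl clPsi.
have smB : small K (with_tuples S).
  apply: card_leU_finite => //; apply: bigcup_finite => // c _.
  exact: finite_range_ord.
have AB : A `<=` with_tuples S by move=> x; left.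
have [b [b1 b2]] := saturated_realize PA satM smB tot.
exists b; split=> //; last first.
  move=> c h Sc hP.
  have [||h' [h'P h'h h'b]] := b1 (range c) _ _ h hP.
  - exact: finite_range_ord.
  - by move=> x cx; right; exists c.
  - by exists h'; split=> //; apply/funext => i /=; rewrite h'h //; exists i.
apply: (same_type_covers PA) => h hP.
  apply: point_compact => D fD DA.
  have [h1 [h1P h1h /Psicl[//|h2 [h2P h2h1 h2a]]]] :=
    b1 D fD (subset_trans DA AB) h hP.
  by exists h2; split=> //; exact: eq_on_trans DA h2h1 h1h.
have [h1 [h1P h1h /b2[//|h2 [h2P h2h1 h2b]]]] := clPsi h hP.
by exists h2; split=> //; exact: eq_on_trans AB h2h1 h1h.
Qed.

Section Dividing.
Variables (n : nat) (theta : formula pattern_language ('I_n + 'I_m)).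
(** [R s f] lets [x] take the value [s] where the parameters take the value [f]; [thetaR] makes it
    an upper bound for what [theta] permits. *)
Variable (R : ('I_n -> bool) -> ('I_m -> bool) -> Prop).
Hypothesis thetaR : forall b x (h : M -> bool), sol theta b x -> is_point h -> R (h \o x) (h \o b).

(** The conjugates of [a] are taken independent over [A]. *)
Lemma divides_of_empty_fiber (h0 : M -> bool) : is_point h0 ->
  (forall s, exists h, [/\ is_point h, eq_on A h h0 & ~ R s (h \o a)]) ->
  divides A theta a.
Proof.
move=> h0P h0R.
pose step (S : set ('I_m -> M)) b := same_type A b a /\ forall h f, is_point h -> type_at h f ->
       exists h', [/\ is_point h', eq_on (with_tuples S) h' h & h' \o b = f].
have [||u uP] := @dependent_sequence _ (fun=> True) step.
- by [].
- move=> S fS _.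
  have [|||b [ba _ b2]] := @saturated_conjugate S type_at fS.
  + by move=> h hP; exists (h \o a), h.
  + by [].
  + by move=> h hP; exists h; split=> //; exists h.
  by exists b.
(* By independence, a single point over [h0] can have each [u i] exclude its own prescribed value
   [sg i]. *)
have indep (sg : nat -> 'I_n -> bool) j : exists h, [/\ is_point h, eq_on A h h0 &
    forall i, (i < j)%N -> ~ R (sg i) (h \o u i)].
  elim: j => [|j [h [hP hh0 hR]]]; first by exists h0.
  have [h1 [h1P h1h0 h1R]] := h0R (sg j).
  have [_ [_ /(_ h (h1 \o a) hP)[|h2 [h2P h2h h2u]]]] := uP j.
    by exists h1; split=> // z Az; rewrite h1h0 // hh0.
  exists h2; split=> //; first by apply: (eq_on_trans _ h2h hh0) => z; left.
  move=> i; rewrite ltnS leq_eqVlt => /orP[/eqP ->|ij]; first by rewrite h2u.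
  rewrite (_ : h2 \o u i = h \o u i); first exact: hR.
  apply/funext => l /=; apply: h2h; right; exists (u i); last by exists l.
  by exists i.
(* The bound is the number of values of [x] at a point. Given that many conjugates, each value is
   assigned to one of them and excluded by it, so at a suitable point no value is left for [x]. *)
exists #|{ffun 'I_n -> bool}|, u; split=> [i|J JI]; first by have [_ []] := uP i.
have [tau tauI JE] := card_eq_range JI.
move=> [x xJ].
pose sg i : 'I_n -> bool := if pselect (exists l, tau l = i) is left P
   then (enum_val (sval (cid P)) : {ffun 'I_n -> bool}) else (fun=> false).
have sgE (s : {ffun 'I_n -> bool}) : sg (tau (enum_rank s)) = s.
  rewrite /sg; case: pselect => [P|[]]; last by exists (enum_rank s).
  by case: cid => l /= /tauI ->; rewrite enum_rankK.
have [h [hP _ hR]] := indep sg (\max_(l : 'I__) tau l).+1.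
pose s := finfun (h \o x).
apply: (hR (tau (enum_rank s))); first by rewrite ltnS; exact: (leq_bigmax (enum_rank s)).
rewrite sgE (_ : (s : _ -> _) = h \o x); last by apply/funext => i; rewrite ffunE.
by apply: thetaR => //; apply: xJ; rewrite JE; exists (enum_rank s).
Qed.

(** The conjugates are chosen so that the part [f] of each of them lies inside
    the part where [s] is excluded by each later one. *)
Lemma divides_of_covered (s : 'I_n -> bool) (f : 'I_m -> bool) :
  R s f ->
  (forall b x, sol theta b x -> exists h : M -> bool, [/\ is_point h, h \o x = s & h \o b = f]) ->
  (forall h, is_point h -> h \o a = f ->
    exists h', [/\ is_point h', eq_on A h' h & ~ R s (h' \o a)]) ->
  divides A theta a.
Proof.
move=> Rsf thetaf cover.
pose outside (S : set ('I_m -> M)) (h : M -> bool) := forall c, S c -> h \o c <> f.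
(* Every fibre over [A] must keep a point outside the parts used so far: there the next conjugate is
   free to take all values that its type over [A] demands. *)
pose good (S : set ('I_m -> M)) := (forall b, S b -> same_type A b a) /\
  forall h, is_point h -> exists h', [/\ is_point h', eq_on A h' h & outside S h'].
pose step (S : set ('I_m -> M)) b := same_type A b a /\
  forall c (h : M -> bool), S c -> is_point h -> h \o c = f -> ~ R s (h \o b).
have [||u uP] := @dependent_sequence _ good step.
- by split=> // h hP; exists h; split.
- move=> S fS [Sa Sout].
  pose Psi h f' := type_at h f' /\ (~ outside S h -> ~ R s f').
  have avoid h : is_point h -> exists f', type_at h f' /\ ~ R s f' \/ h \o a <> f.
    move=> hP; have [/(cover _ hP)[h' [h'P h'h nR]]|nf] := pselect (h \o a = f).
      by exists (h' \o a); left; split=> //; exists h'.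
    by exists f; right.
  have [|||b [ba b1 b2]] := @saturated_conjugate S Psi fS.
  + move=> h hP; have [oh|noh] := pselect (outside S h).
      by exists (h \o a); split=> //; exists h.
    have [c [Sc hc]] : exists c, S c /\ h \o c = f.
      by apply: contrapT => nc; apply: noh => c Sc hc; apply: nc; exists c.
    have [h1 [h1P h1h h1a]] := covers_same_type PA (Sa c Sc) hP.
    have [|h2 [h2P h2h1 nR]] := cover h1 h1P; first by rewrite h1a.
    exists (h2 \o a); split=> //; exists h2; split=> //.
    exact: (eq_on_trans _ h2h1 h1h).
  + by move=> h f' _ [].
  + move=> h hP; have [h1 [h1P h1h h1o]] := Sout h hP.
    by exists h1; split=> //; split=> //; exists h; split=> // z Az; rewrite h1h.
  exists b; split; first split=> //.
    move=> c h Sc hP hc; have [h' [h'P h'c [_ nR]]] := b1 c h Sc hP.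
    by apply: nR => /(_ c Sc); rewrite h'c.
  split=> [c [/Sa//|->//]|h hP].
  have [h1 [h1P h1h h1o]] := Sout h hP.
  (* In the fibre of [h1] the type of [a] has a value other than [f]: one excluding [s], as [R s f]
     holds, or the value of [a] at [h1]. Giving it to [b] keeps a point of the fibre outside. *)
  have [f' [f'h1 f'f]] : exists f', type_at h1 f' /\ f' <> f.
    have [f' [[tf' nR]|nf]] := avoid h1 h1P.
      by exists f'; split=> // f'f; apply: nR; rewrite f'f.
    by exists (h1 \o a); split=> //; exists h1.
  have [|h2 [h2P h2h1 h2b]] := b2 h1 f' h1P; first by split.
  exists h2; split=> //.
    by apply: (eq_on_trans _ h2h1 h1h) => z; left.
  move=> c [Sc|->]; last by rewrite h2b.
  rewrite (_ : h2 \o c = h1 \o c); first exact: h1o.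
  by apply/funext => i /=; apply: h2h1; right; exists c => //; exists i.
(* Two conjugates suffice: for [i < j], a solution at [u i] has a point where [x] is [s] and [u i]
   is [f], and there [u j] excludes [s]. *)
exists 2, u; split=> [i|J JI]; first by have [_ []] := uP i.
have [tau tauI JE] := card_eq_range JI.
move=> [x xJ].
have contra i j : J i -> J j -> (i < j)%N -> False.
  move=> Ji Jj ij; have [_ [_ uj]] := uP j.
  have [h [hP hx hu]] := thetaf _ _ (xJ i Ji).
  apply: (uj (u i) h) => //.
  by rewrite -hx; apply: thetaR => //; exact: xJ.
have J0 : J (tau ord0) by rewrite JE; exists ord0.
have J1 : J (tau ord_max) by rewrite JE; exists ord_max.
by case: (ltngtP (tau ord0) (tau ord_max)) => [||/tauI//]; exact: contra.
Qed.

End Dividing.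
End Conjugates.

(** * From nonforking to invariant types, and the chain condition *)

Lemma same_type_one m (a : nat -> 'I_m -> M) :
  indiscernible A a -> same_type A (a 0) (a 1).
Proof.
move=> ind phi.
have homo c : {homo (fun _ : 'I_1 => c) : i j / (i < j)%N}.
  by move=> i j; rewrite !ord1.
have := ind 1 (fun=> 0) (fun=> 1) (homo 0) (homo 1).
pose g (z : 'I_m + A) : 'I_1 * 'I_m + A :=
  match z with inl i => inl (ord0, i) | inr x => inr x end.
move=> /(_ (fren g phi)).
have E (c : 'I_m -> M) : joint (fun z : 'I_1 * 'I_m => c z.2) (@set_val M A) \o g =
    joint c (@set_val M A) by apply/funext; case.
have solE (c : 'I_m -> M) : sol (fren g phi) (@set_val M A) (fun z : 'I_1 * 'I_m => c z.2)
    <-> sol phi (@set_val M A) c.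
  by rewrite /sol -[X in X <-> _]/(holds _ (joint _ _)) holds_fren E.
by rewrite !solE.
Qed.

Definition joint_pattern n m (x : 'I_n -> M) (b : 'I_m -> M) s f : Prop :=
  exists h, [/\ is_point h, h \o x = s & h \o b = f].

(** By quantifier elimination these formulas isolate the complete types of pairs of tuples, and for
    given [n] and [m] they are finite in number. *)
Definition pattern_formula n m (Z : {set {ffun 'I_(n + m) -> bool}}) :
    formula pattern_language ('I_n + 'I_m) :=
  atom Z (cat_fun inl inr).

Lemma sol_pattern_formula n m (Z : {set {ffun 'I_(n + m) -> bool}})
    (x0 x : 'I_n -> M) (a b : 'I_m -> M) :
  pat Z (cat_fun x0 a) -> sol (pattern_formula Z) b x <->
    forall s f, joint_pattern x b s f <-> joint_pattern x0 a s f.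
Proof.
move=> /(patP PA) Zx0.
have E : joint x b \o cat_fun inl inr = cat_fun x b by rewrite comp_cat_fun.
have solE : sol (pattern_formula Z) b x <-> pat Z (cat_fun x b).
  by rewrite -E; exact: holds_atom.
have jpE (y : 'I_n -> M) (c : 'I_m -> M) s f : joint_pattern y c s f <->
    exists2 h, is_point h & forall i, h (cat_fun y c i) = finfun (cat_fun s f) i.
  split=> [[h [hP <- <-]]|[h hP hE]]; exists h => //.
    by move=> i; rewrite ffunE -comp_cat_fun.
  split=> //; apply/funext => i.
    by have := hE (lshift m i); rewrite ffunE !cat_fun_lshift.
  by have := hE (rshift n i); rewrite ffunE !cat_fun_rshift.
rewrite solE (patP PA); split=> [Zx s f|H F].
  by rewrite !jpE -Zx -Zx0.
have FE : F = finfun (cat_fun (F \o lshift m) (F \o @rshift n m)).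
  apply/ffunP => i; rewrite ffunE -(splitK i) /cat_fun unsplitK.
  by case: (fintype.split i).
by rewrite Zx0 FE -!jpE; split=> /H.
Qed.

Lemma sol_joint_pattern n m (phi : formula pattern_language ('I_n + 'I_m))
    (x x' : 'I_n -> M) (b b' : 'I_m -> M) :
  (forall s f, joint_pattern x b s f <-> joint_pattern x' b' s f) ->
  sol phi b x -> sol phi b' x'.
Proof.
move=> H; apply: (holds_coversT PA) => h hP.
  have [|h' [h'P h'x h'b]] := (H (h \o x) (h \o b)).1; first by exists h.
  by exists h' => // -[i|i] _ /=; [have := congr1 (@^~ i) h'x|have := congr1 (@^~ i) h'b].
have [|h' [h'P h'x h'b]] := (H (h \o x') (h \o b')).2; first by exists h.
by exists h' => // -[i|i] _ /=; [have := congr1 (@^~ i) h'x|have := congr1 (@^~ i) h'b].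
Qed.

(** [Q] gives the patterns of a global [A]-invariant type. *)
Lemma nonforking_invariant n m (phi : formula pattern_language ('I_n + 'I_m))
    (a : 'I_m -> M) :
  ~ forks A (sol phi a) ->
  exists (Q : ('I_n -> bool) -> (M -> bool) -> Prop) (x0 : 'I_n -> M), [/\ sol phi a x0,
    forall s h h', eq_on A h h' -> Q s h -> Q s h',
    forall h, is_point h -> exists s, Q s h &
    forall s f, joint_pattern x0 a s f <-> exists h, [/\ is_point h, Q s h & h \o a = f]].
Proof.
move=> nforks.
have [x0 [phix0 [Z [Zx0 ndiv]]]] : exists x0, sol phi a x0 /\
    exists Z, pat Z (cat_fun x0 a) /\ ~ divides A (pattern_formula Z) a.
  apply: contrapT => H; apply: nforks.
  (* If every solution of [phi] had a dividing pattern, the finitely many dividing patterns would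
     witness forking. *)
  pose D := [set Z | `[< divides A (@pattern_formula n m Z) a >]]%SET.
  exists #|D|, (fun=> m), (fun i => pattern_formula (enum_val i)), (fun=> a).
  split=> [i|x phix]; first by have := enum_valP i; rewrite inE => /asboolP.
  have [Z Zx] := pat_ex PA (cat_fun x a).
  have ZD : Z \in D.
    rewrite inE; apply/asboolP; apply: contrapT => nd.
    by apply: H; exists x; split=> //; exists Z.
  exists (enum_rank_in ZD Z) => //=.
  by rewrite enum_rankK_in //; apply/(sol_pattern_formula _ _ Zx).
have thetaP b x := sol_pattern_formula x b Zx0.
pose R s f := joint_pattern x0 a s f.
have thetaR b x (h : M -> bool) : sol (pattern_formula Z) b x -> is_point h -> R (h \o x) (h \o b).
  by move=> /(thetaP b x).1 H hP; apply/H; exists h.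
(* Asking for [s] on the whole fibre over [A] makes [Q] invariant; the two dividing lemmas show that
   nothing essential is lost. *)
pose Q s h := forall h', is_point h' -> eq_on A h' h -> R s (h' \o a).
have nQ s h : ~ Q s h -> exists h', [/\ is_point h', eq_on A h' h & ~ R s (h' \o a)].
  move=> nq; apply: contrapT => H; apply: nq => h' h'P h'h; apply: contrapT => nR.
  by apply: H; exists h'.
exists Q, x0; split=> //.
- move=> s h h' hh' Qh h2 h2P h2h'; apply: Qh => // z Az.
  by rewrite h2h' // hh'.
- move=> h hP; apply: contrapT => H; apply: ndiv.
  apply: (divides_of_empty_fiber thetaR hP) => s; apply: nQ => Qs.
  by apply: H; exists s.
- move=> s f; split=> [Rsf|[h [hP Qh <-]]]; last exact: Qh.
  apply: contrapT => H; apply: ndiv; apply: (divides_of_covered thetaR Rsf).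
    by move=> b x /(thetaP b x).1 E; apply/E.
  move=> h hP ha; apply: nQ => Qh; apply: H.
  by exists h.
Qed.

Theorem chain_condition_pattern_algebra : chain_condition A.
Proof.
move=> n m phi a /same_type_one a01 /nonforking_invariant[Q [x0 [phix0 Qinv Qtot x0Q]]].
move=> [r [l [psi [b [psidiv cover]]]]].
have kbP i : exists kb : nat * (nat -> 'I_(l i) -> M),
    (forall j, same_type A (kb.2 j) (b i)) /\
    k_inconsistent kb.1 (fun j => sol (psi i) (kb.2 j)).
  by have [k [c [c1 c2]]] := psidiv i; exists (k, c).
pose k i := (sval (cid (kbP i))).1; pose c i := (sval (cid (kbP i))).2.
have cb i j : same_type A (b i) (c i j).
  by apply: same_typeC; rewrite /c; case: cid => ? [].
have cinc i : k_inconsistent (k i) (fun j => sol (psi i) (c i j)).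
  by rewrite /k /c; case: cid => ? [].
(* The contradiction involves finitely many parameters: two terms of the sequence, the parameters of
   the cover, and [k i] conjugates of each. Realizing the invariant type over them suffices. *)
pose D : set M := (range (a 0) `|` range (a 1)) `|`
  \bigcup_(i in [set: 'I_r]) (range (b i) `|` \bigcup_(j in `I_(k i)) range (c i j)).
have fD : finite_set D.
  rewrite !finite_setU; do !split; try exact: finite_range_ord.
  apply: bigcup_finite => [|i _]; first exact: finite_finset.
  rewrite finite_setU; split; first exact: finite_range_ord.
  by apply: bigcup_finite => [|j _]; [exact: finite_II|exact: finite_range_ord].
have [x [x1 x2]] := @realize_over_finite M PA D n (fun h s => Q s h) fD Qtot.
have onD p (d : 'I_p -> M) (h h' : M -> bool) : range d `<=` D ->
    (forall z, D z -> h' z = h z) -> h' \o d = h \o d.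
  by move=> dD hh'; apply/funext => i; apply: hh'; apply: dD; exists i.
(* Invariance at work: a point moves to one with the same trace on [A] where [e] has the old value
   of [d]. [Q] still allows the value of [x] there. *)
have inv p (d e : 'I_p -> M) s f : range d `<=` D -> range e `<=` D ->
    same_type A d e -> joint_pattern x d s f -> joint_pattern x e s f.
  move=> dD eD /(covers_same_type PA) de [h [hP <- <-]].
  have [h1 [h1P /(onD _ _ _ _ dD) <- Qh1]] := x1 h hP.
  have [h2 [h2P h2h1 <-]] := de h1 h1P.
  have [|h3 [h3P /(onD _ _ _ _ eD) <- h3x]] := x2 h2 (h \o x) h2P.
    by apply: Qinv Qh1 => z Az; rewrite h2h1.
  by exists h3.
have a0D : range (a 0) `<=` D by move=> z az; left; left.
have a1D : range (a 1) `<=` D by move=> z az; left; right.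
have phi0 : sol phi (a 0) x.
  apply: sol_joint_pattern phix0 => s f; rewrite x0Q; split.
    move=> [h [hP Qh <-]]; have [h' [h'P /(onD _ _ _ _ a0D) <- h'x]] := x2 h s hP Qh.
    by exists h'.
  move=> [h [hP <- <-]]; have [h' [h'P /(onD _ _ _ _ a0D) <- Qh']] := x1 h hP.
  by exists h'.
have phi1 : sol phi (a 1) x.
  apply: sol_joint_pattern phi0 => s f.
  by split; apply: inv => //; exact: same_typeC.
have [i _ psix] := cover x (conj phi0 phi1).
(* By invariance [x] satisfies [psi i] at all [k i] conjugates, against [k i]-inconsistency. *)
have biD : range (b i) `<=` D by move=> z bz; right; exists i => //; left.
apply: (cinc i `I_(k i)) => //; exists x => j jk /=.
have cjD : range (c i j) `<=` D.
  by move=> z cz; right; exists i => //; right; exists j.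
apply: sol_joint_pattern psix => s f.
by split; apply: inv => //; exact: same_typeC.
Qed.

End ChainCondition.

(** * Ultrapowers *)

Section Ultrapower.
Variables (L : language) (N : structure L) (U : set_system nat).
Hypotheses (UU : UltraFilter U) (Uoo : \oo `<=` U).

#[local] Instance U_filter : Filter U := @filter_filter _ _ (@ultra_proper _ _ UU).

Definition germ (f : nat -> N) : set (nat -> N) := [set g | \forall i \near U, g i = f i].

Definition germs : Type := {X : set (nat -> N) | exists f, X = germ f}.

Definition to_germ (f : nat -> N) : germs := exist _ (germ f) (ex_intro _ f erefl).

Definition repr_germ (x : germs) : nat -> N := sval (cid (svalP x)).

Lemma repr_germK x : to_germ (repr_germ x) = x.
Proof. by rewrite /repr_germ; case: cid; case: x => X HX /= f Xf; exact: eq_exist. Qed.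

Lemma eq_to_germ f g : to_germ f = to_germ g <-> \forall i \near U, f i = g i.
Proof.
split=> [[fg]|fg].
  have : germ f f by apply: filterE.
  by rewrite fg.
apply: eq_exist; apply/seteqP; split=> h /= H;
  by apply: filterS2 H fg => i -> ->.
Qed.

Lemma repr_to_germ f : \forall i \near U, repr_germ (to_germ f) i = f i.
Proof. by apply/eq_to_germ; rewrite repr_germK. Qed.

Definition ultrapower : structure L :=
  @Structure L germs (let: inhabits x := carrier_inhabited N in inhabits (to_germ (fun=> x)))
    (fun f args => to_germ (fun i => fint (fun j => repr_germ (args j) i)))
    (fun r args => \forall i \near U, rint (fun j => repr_germ (args j) i)).

Lemma eval_ultrapower (V : Type) (v : V -> ultrapower) (t : term L V) :
  \forall i \near U, repr_germ (eval v t) i = eval (fun z => repr_germ (v z) i) t.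
Proof.
elim: t => [x|f ts IH] /=; first exact: filterE.
have {}IH : \forall i \near U, forall j, repr_germ (eval v (ts j)) i =
    eval (fun z => repr_germ (v z) i) (ts j) by exact: filter_forall.
have := repr_to_germ (fun i => fint (fun j => repr_germ (eval v (ts j)) i)).
by apply: filterS2 IH => i /funext -> ->.
Qed.

Lemma near_not (P : set nat) : U (~` P) <-> ~ U P.
Proof.
split=> [UC UP|nU]; last by case: (in_ultra_setVsetC P UU).
by have [i []] := @filter_ex _ U _ _ (filterI UP UC).
Qed.

Lemma los (V : Type) (phi : formula L V) (v : V -> ultrapower) :
  holds phi v <-> \forall i \near U, holds phi (fun z => repr_germ (v z) i).
Proof.
elim: phi v => {V} [V|V s t|V r ts|V p IHp q IHq|V p IHp] v /=.
- by split=> // /(@filter_ex _ U _)[].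
- split=> E.
    by apply: filterS2 (eval_ultrapower v s) (eval_ultrapower v t) => i <- <-; rewrite E.
  rewrite -[LHS]repr_germK -[RHS]repr_germK; apply/eq_to_germ.
  by apply: filterS3 (eval_ultrapower v s) (eval_ultrapower v t) E => i -> ->.
- have Uts : \forall i \near U, forall j,
      repr_germ (eval v (ts j)) i = eval (fun z => repr_germ (v z) i) (ts j).
    by apply: filter_forall => j; exact: eval_ultrapower.
  by split=> H; apply: filterS2 Uts H => i /funext ->.
- rewrite IHp IHq; split=> [H|H Up]; last by apply: filterS2 H Up => i; apply.
  have [/H|/near_not] := pselect (\forall i \near U, holds p (fun z => repr_germ (v z) i));
    by apply: filterS => i // Hq /Hq.
- have E x i : (fun z => repr_germ (extend v x z) i) =
      extend (fun z => repr_germ (v z) i) (repr_germ x i) by apply/funext; case.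
  split=> [H|H x]; last first.
    by apply/IHp; apply: filterS H => i /(_ (repr_germ x i)); rewrite E.
  apply: contrapT => /near_not nU.
  (* [f] picks a counterexample at each index that has one, and an arbitrary element elsewhere. *)
  have /boolp.choice[f fP] i : exists x,
      (exists y, ~ holds p (extend (fun z => repr_germ (v z) i) y)) -> ~ holds p (extend (fun z => repr_germ (v z) i) x).
    have [[y ny]|nn] := pselect (exists y, ~ holds p (extend (fun z => repr_germ (v z) i) y)).
      by exists y.
    by case: (carrier_inhabited N) => x; exists x => /nn.
  have /IHp H1 := H (to_germ f).
  have [i [[/= ny Hy] ef]] := @filter_ex _ U _ _ (filterI (filterI nU H1) (repr_to_germ f)).
  move: Hy; rewrite E ef; apply: fP; apply: contrapT => ne.
  by apply: ny => y; apply: contrapT => nh; apply: ne; exists y.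
Qed.

Lemma ultrapower_models : models (theory N) ultrapower.
Proof.
move=> s Ns; apply/los; apply: filterE => i.
by rewrite (_ : (fun _ => _) = of_void N) //; apply/funext; case.
Qed.

(** Finitely many chosen representatives agree with the given sequences on a common set in [U]. *)
Lemma los_to_germ (V : Type) (phi : formula L V) (u : V -> nat -> N) :
  finite_set [set: V] ->
  holds phi (fun z => to_germ (u z) : ultrapower) <->
  \forall i \near U, holds phi (fun z => u z i).
Proof.
move=> /finite_set_range[k [w Vw]].
have Uw : \forall i \near U, forall j, repr_germ (to_germ (u (w j))) i = u (w j) i.
  by apply: filter_forall => j; exact: repr_to_germ.
have {}Uw : \forall i \near U, (fun z => repr_germ (to_germ (u z)) i) = (fun z => u z i).
  apply: filterS Uw => i Ei; apply/funext => z.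
  have : range w z by rewrite -Vw.
  by move=> [j _ <-].
by rewrite los; split=> H; apply: filterS2 Uw H => i ->.
Qed.

(** [P] decreases with its index, so a witness for the largest satisfiable index up to [b] serves
    all smaller ones. *)
Lemma best_below (X : Type) (P : nat -> X -> Prop) : inhabited X ->
  (forall i j x, (i <= j)%N -> P j x -> P i x) ->
  forall b, exists c, forall i, (i <= b)%N -> (exists x, P i x) -> P i c.
Proof.
move=> [x0] Pdec; elim=> [|b [c cP]].
  have [[x Px]|nP] := pselect (exists x, P 0 x).
    by exists x => i; rewrite leqn0 => /eqP ->.
  by exists x0 => i; rewrite leqn0 => /eqP -> /nP.
have [[x Px]|nP] := pselect (exists x, P b.+1 x).
  by exists x => i ib _; exact: Pdec Px.
by exists c => i; rewrite leq_eqVlt => /orP[/eqP -> /nP//|]; exact: cP.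
Qed.

(** A type over a countable set has countably many formulas. Coordinate [i] satisfies those of code
    at most [k] for the largest possible [k <= i]. Each initial stretch is satisfiable at almost all
    coordinates, and almost all coordinates lie beyond it as [U] contains the cofinite sets. *)
Lemma ultrapower_saturated :
  (forall V : Type, [set: V] #<= [set: nat] -> [set: formula L V] #<= [set: nat]) ->
  saturated nat ultrapower.
Proof.
move=> countL A smA n p pcons.
have /card_leT_inj[c0 c0I] : [set: formula L ('I_n + A)] #<= [set: nat].
  apply: countL; have /card_leT_inj[f fI] := smA.
  pose g (z : 'I_n + A) :=
    match z with inl i => pickle (0, nat_of_ord i) | inr x => pickle (1, f x) end.
  apply: (@card_le_inj _ _ _ g) => -[i|x] [j|y] _ _ /(pcan_inj pickleK) // [].
    by move=> /val_inj ->.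
  by move=> /fI ->.
pose c phi := c0 (exist _ phi (in_setT phi)).
have cI : injective c by move=> phi psi /c0I[].
pose par (x : 'I_n -> N) i : 'I_n + A -> N :=
  joint x (fun y => repr_germ (@set_val _ A y) i).
pose G i k (x : 'I_n -> N) := forall phi, p phi -> (c phi <= k)%N -> holds phi (par x i).
have G_ex k : \forall i \near U, exists x, G i k x.
  pose J := [set phi | p phi /\ (c phi <= k)%N].
  have fJ : finite_set J.
    apply: (@sub_finite_set _ _ (c @^-1` `I_k.+1)) => [phi [_] //|].
    by apply: finite_preimage (finite_II _) => x y _ _ /cI.
  have [x xJ] := pcons J fJ (fun phi => @proj1 _ _).
  have [l [w Jw]] := finite_set_range fJ.
  have : \forall i \near U, forall j, holds (w j) (par (fun z => repr_germ (x z) i) i).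
    apply: filter_forall => j.
    have /xJ/los : J (w j) by rewrite Jw; exists j.
    by apply: filterS => i; congr holds; apply/funext; case.
  apply: filterS => i H; exists (fun z => repr_germ (x z) i) => phi pphi ck.
  have : J phi by [].
  by rewrite Jw => -[j _ <-].
have N0 : inhabited ('I_n -> N) by case: (carrier_inhabited N) => x; apply: inhabits => _.
have /boolp.choice[d dP] i : exists x, forall k, (k <= i)%N -> (exists x, G i k x) -> G i k x.
  apply: best_below => // k l x kl H phi pphi ck; apply: H => //.
  exact: leq_trans kl.
exists (fun z => to_germ (fun i => d i z)) => phi pphi.
apply/los.
have Ud : \forall i \near U, forall z, repr_germ (to_germ (fun i => d i z)) i = d i z.
  by apply: filter_forall => z; exact: repr_to_germ.
have Uge : \forall i \near U, (c phi <= i)%N by apply: Uoo; exists (c phi).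
apply: filterS3 Ud Uge (G_ex (c phi)) => i di ci Gi.
have := dP i _ ci Gi phi pphi (leqnn _).
by congr holds; apply/funext => -[z|//] /=; rewrite di.
Qed.

End Ultrapower.

(** * Countability of the set of formulas *)

Fixpoint code (V : Type) (phi : formula pattern_language V) (e : V -> nat) : GenTree.tree nat :=
  let tcode (t : term pattern_language V) :=
    match t with Var x => e x | App f _ => match f with end end in
  match phi with
  | Bot => GenTree.Node 0 [::]
  | Eq s t => GenTree.Node 1 [:: GenTree.Leaf (tcode s); GenTree.Leaf (tcode t)]
  | Rel r ts => GenTree.Node 2 (GenTree.Leaf (pickle r) ::
      [seq GenTree.Leaf (tcode (ts i)) | i <- enum 'I_(rarity r)])
  | Imp p q => GenTree.Node 3 [:: code p e; code q e]
  | All p => GenTree.Node 4 [:: code p (fun o => if o is Some y then (e y).+1 else 0)]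
  end.

(** Under [All] the bound variable is coded by 0 and the others are shifted, so injectivity of [e]
    survives the induction. *)
Lemma code_inj (V : Type) (phi psi : formula pattern_language V) (e : V -> nat) :
  injective e -> code phi e = code psi e -> phi = psi.
Proof.
have tinj (W : Type) (d : W -> nat) (s t : term pattern_language W) : injective d ->
    match s with Var x => d x | App f _ => match f with end end =
    match t with Var x => d x | App f _ => match f with end end -> s = t.
  by move=> dI; case: s => [x|[]]; case: t => [y|[]] /dI ->.
elim: phi psi e => {V} [V|V s t|V r ts|V p IHp q IHq|V p IHp] [|s' t'|r' ts'|p' q'|p'] e eI //=.
- by move=> [/(tinj _ _ _ _ eI) -> /(tinj _ _ _ _ eI) ->].
- move=> [/(pcan_inj pickleK) rr]; case: _ / rr ts' => ts' E.
  congr Rel; apply/funext => i; apply: (tinj _ _ _ _ eI).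
  by move/eq_in_map: E => /(_ i (mem_enum _ _))[].
- by move=> [/(IHp _ _ eI) -> /(IHq _ _ eI) ->].
- move=> [] E; congr All; apply: IHp E.
  by move=> [x|] [y|] // [] /eI ->.
Qed.

Lemma countable_formula (V : Type) :
  [set: V] #<= [set: nat] -> [set: formula pattern_language V] #<= [set: nat].
Proof.
move=> /card_leT_inj[f fI]; pose e x := f (exist _ x (in_setT x)).
have eI : injective e by move=> x y /fI[].
apply: (@card_le_inj _ _ _ (fun phi => pickle (code phi e))) => phi psi _ _.
by move=> /(pcan_inj pickleK)/(code_inj eI).
Qed.

(** * The clopen algebra of the Cantor space *)

Definition finitely_supported n (X : (nat -> bool) -> bool) : Prop :=
  forall w w' : nat -> bool, (forall i, (i < n)%N -> w i = w' i) -> X w = X w'.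

Definition clopen : Type := {X : (nat -> bool) -> bool | exists n, finitely_supported n X}.

Definition Clopen X (HX : exists n, finitely_supported n X) : clopen := exist _ X HX.

Lemma clopen0_subproof : exists n, finitely_supported n (fun=> false).
Proof. by exists 0. Qed.

Definition clopen_algebra : structure pattern_language :=
  @Structure pattern_language clopen (inhabits (Clopen clopen0_subproof))
    (fun f => match f with end)
    (fun r v => forall f, f \in tagged r <-> exists w, forall i, sval (v i) w = f i).

Lemma clopen_support k (v : 'I_k -> clopen) :
  exists n, forall i, finitely_supported n (sval (v i)).
Proof.
pose N i := sval (cid (svalP (v i))).
exists (\max_(i < k) N i) => i w w' ww'.
apply: (svalP (cid (svalP (v i)))) => j jN; apply: ww'.
exact: leq_trans jN (leq_bigmax i).
Qed.

(** The work is in [pat_ext]. The [n] coordinates from [N] on, which no [v i] depends on, are read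
    as proposed values of the new elements; a proposal outside [W] is replaced by a fixed member of
    [W] over the same trace. *)
Lemma clopen_pattern_algebra : pattern_algebra clopen_algebra.
Proof.
split.
- move=> k v; exists [set f : {ffun 'I_k -> bool} |
    `[< exists w, forall i, sval (v i) w = f i >]]%SET => f.
  by rewrite /= inE; split => /asboolP.
- move=> k v Z Z' Zv Z'v; apply/setP => f.
  by apply/idP/idP => [/Zv/(Z'v f).2|/Z'v/(Zv f).2].
- move=> k l g Z v Zv f /=; split.
    move=> /imsetP[f' /Zv[w wf'] ->]; exists w => i; by rewrite ffunE wf'.
  move=> [w wf]; apply/imsetP; exists [ffun i => sval (v i) w].
    by apply/Zv; exists w => i; rewrite ffunE.
  by apply/ffunP => i; rewrite !ffunE wf.
- move=> k n W v Wv; have [N vN] := clopen_support v.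
  pose cand w : {ffun 'I_(k + n) -> bool} :=
    finfun (cat_fun (fun i => sval (v i) w) (fun l => w (N + l))).
  pose default w := odflt (cand w) [pick F in W |
    [ffun i => (F : {ffun 'I_(k + n) -> bool}) (lshift n i)] == [ffun i => sval (v i) w]].
  pose F w := if cand w \in W then cand w else default w.
  have Fsupp w w' : (forall i, (i < N + n)%N -> w i = w' i) -> F w = F w'.
    move=> ww'.
    have vw : (fun i => sval (v i) w) = (fun i => sval (v i) w').
      apply/funext => i; apply: vN => j jN; apply: ww'.
      exact: leq_trans jN (leq_addr _ _).
    have cw : cand w = cand w'.
      apply/ffunP => i; rewrite !ffunE vw; congr cat_fun.
      by apply/funext => l; apply: ww'; rewrite ltn_add2l.
    by rewrite /F /default cw vw.
  have FW w : F w \in W /\ forall i, F w (lshift n i) = sval (v i) w.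
    rewrite /F; case: ifP => [cW|_].
      by split=> // i; rewrite ffunE cat_fun_lshift.
    rewrite /default; case: pickP => [G /andP[GW /eqP/ffunP Gv]|nG] /=.
      by split=> // i; have := Gv i; rewrite !ffunE.
    have /imsetP[G GW GE] : [ffun i => sval (v i) w] \in [set [ffun i =>
        (f : {ffun 'I_(k + n) -> bool}) (lshift n i)] | f in W]%SET.
      by apply/Wv; exists w => i; rewrite ffunE.
    by have := nG G; rewrite GW GE eqxx.
  have ysupp j : exists l, finitely_supported l (fun w => F w (rshift k j)).
    by exists (N + n) => w w' /Fsupp ->.
  pose y j := Clopen (ysupp j).
  exists y => G /=.
  have yF w i : sval (cat_fun v y i) w = F w i.
    rewrite -(splitK i); case: (fintype.split i) => j /=.
      by rewrite cat_fun_lshift (FW w).2.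
    by rewrite cat_fun_rshift.
  split=> [GW|[w wG]]; last first.
    by rewrite (_ : G = F w) ?(FW w).1 //; apply/ffunP => i; rewrite -wG yF.
  have /Wv[w0 w0G] : [ffun i => G (lshift n i)] \in [set [ffun i =>
        (f : {ffun 'I_(k + n) -> bool}) (lshift n i)] | f in W]%SET.
    by apply/imsetP; exists G.
  (* Below [N] the point follows [w0], and on the fresh coordinates it spells the new values of [G],
     so its proposal is [G]. *)
  pose w i := if (i < N)%N then w0 i else
    if insub (i - N) : option 'I_n is Some l then G (rshift k l) else false.
  have wN l : w (N + val l) = G (rshift k l).
    by rewrite /w ltnNge leq_addr /= addKn valK.
  have cG : cand w = G.
    apply/ffunP => i; rewrite ffunE -(splitK i); case: (fintype.split i) => j /=.
      rewrite cat_fun_lshift (vN j w w0); first by rewrite w0G ffunE.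
      by move=> l lN; rewrite /w lN.
    by rewrite cat_fun_rshift wN.
  by exists w => i; rewrite yF /F cG GW.
- move=> Z [X HX] [Y HY] Zd Zxy; apply: eq_exist; apply/funext => w.
  have := Zd [ffun i => sval (pair_fun (Clopen HX : clopen_algebra) (Clopen HY) i) w].
  rewrite !ffunE; apply.
  by apply/Zxy; exists w => i; rewrite ffunE.
Qed.

(** The formula [z = x /\ y] of Boolean algebras, with [x] in ['I_1] and
    [(y, z)] in ['I_2]. *)
Definition meet_formula : formula pattern_language ('I_1 + 'I_2) :=
  foldr (fun Z psi => Imp (Not (pattern_formula Z)) psi) Bot
    (enum [set Z : {set {ffun 'I_(1 + 2) -> bool}} | [forall f in Z,
      f (rshift 1 ord_max) == f (lshift 2 ord0) && f (rshift 1 ord0)]]%SET).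

Lemma sol_meet_formula (x : 'I_1 -> clopen_algebra) (b : 'I_2 -> clopen_algebra) :
  sol meet_formula b x <->
  forall w, sval (b ord_max) w = sval (x ord0) w && sval (b ord0) w.
Proof.
have holdsE Z : holds (pattern_formula Z) (joint x b) <-> pat Z (cat_fun x b).
  by rewrite holds_atom comp_cat_fun.
rewrite /sol -[X in X <-> _]/(holds _ (joint x b)) holds_exists_seq; split.
  move=> [Z]; rewrite mem_enum inE => /forallP ZP /holdsE Zxb w.
  have := ZP [ffun i => sval (cat_fun x b i) w].
  rewrite !ffunE cat_fun_lshift !cat_fun_rshift => /implyP ZP'.
  by apply/eqP/ZP'/Zxb; exists w => i; rewrite ffunE.
have [Z Zxb] := pat_ex clopen_pattern_algebra (cat_fun x b) => H.
exists Z; last exact/holdsE.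
rewrite mem_enum inE; apply/forallP => f; apply/implyP => /Zxb[w wf].
by rewrite -!wf cat_fun_lshift !cat_fun_rshift H.
Qed.

(** * An array of clopen sets witnessing [TP2] *)

Definition first_at i (w : nat -> bool) : bool := w i && all (fun l => ~~ w l) (iota 0 i).

Lemma first_at_inj i j w : first_at i w -> first_at j w -> i = j.
Proof.
have aux k l : first_at k w -> first_at l w -> (k < l)%N -> False.
  move=> /andP[wk _] /andP[_ /allP/(_ k)] H kl.
  by have := H; rewrite mem_iota kl wk => /(_ isT).
by move=> wi wj; case: (ltngtP i j) => // [/(aux _ _ wi wj)|/(aux _ _ wj wi)].
Qed.

Lemma first_at_support i n : (i < n)%N -> finitely_supported n (first_at i).
Proof.
move=> il w w' ww'; rewrite /first_at ww' //; congr andb.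
apply: eq_in_all => l; rewrite mem_iota /= add0n => li.
by rewrite ww' // (ltn_trans li).
Qed.

Lemma row_subproof i : exists n, finitely_supported n (first_at i).
Proof. by exists i.+1; exact: first_at_support. Qed.

(** On row [i] the coordinate [i + j + 1] is unconstrained, so the cells of one row are pairwise
    distinct. *)
Lemma cell_subproof i j :
  exists n, finitely_supported n (fun w => first_at i w && w (i + j).+1).
Proof.
exists (i + j).+2 => w w' ww'; rewrite (first_at_support _ ww') ?ww' //.
by rewrite ltnS -addnS leq_addr.
Qed.

(** This union meets each of the first [n] rows in exactly the cell chosen by [f], the rows being
    disjoint. Over all rows at once it would not be clopen. *)
Lemma path_subproof n (f : nat -> nat) : exists l, finitely_supported l
  (fun w => has (fun i => first_at i w && w (i + f i).+1) (iota 0 n)).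
Proof.
elim: n => [|n [l lP]]; first by exists 0.
have [k kP] := cell_subproof n (f n).
exists (maxn l k) => w w' ww'; rewrite -addn1 iotaD !has_cat /= !orbF.
by congr orb; [apply: lP|apply: kP] => i il; apply: ww'; rewrite leq_max il ?orbT.
Qed.

Definition row i : clopen_algebra := Clopen (row_subproof i).
Definition cell i j : clopen_algebra := Clopen (cell_subproof i j).
Definition path_clopen n f : clopen_algebra := Clopen (path_subproof n f).

Lemma sol_path_clopen n f i : (i < n)%N ->
  sol meet_formula (pair_fun (row i) (cell i (f i))) (fun=> path_clopen n f).
Proof.
move=> il; apply/sol_meet_formula => w /=.
apply/idP/idP => [/andP[iw iwf]|/andP[/hasP[i' _ /andP[i'w wf]] iw]].
  rewrite iw andbT; apply/hasP; exists i; rewrite ?iw //.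
  by rewrite mem_iota.
by rewrite iw /= (first_at_inj iw i'w).
Qed.

(** The array is carried by constant sequences into an ultrapower, which is a monster model for
    [K := nat]; the theorem of Łoś brings both requirements back to the clopen algebra. *)
Lemma clopen_has_TP2 : has_TP2 (theory clopen_algebra).
Proof.
have [U [UU Uoo]] := ultraFilterLemma eventually_filter.
pose M := ultrapower clopen_algebra U.
exists 1, 2, meet_formula, nat, M; split.
  split; [exact: ultrapower_models|exact: countable_formula (card_lexx _)|].
  apply: ultrapower_saturated => //; exact: countable_formula.
pose a i j := pair_fun (row i) (cell i j).
pose a' i j (l : 'I_2) : M := to_germ U (fun=> a i j l).
have solE i j (x : 'I_1 -> M) : sol meet_formula (a' i j) x <->
    \forall l \near U, sol meet_formula (a i j) (fun z => repr_germ (x z) l).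
  pose u (z : 'I_1 + 'I_2) := match z with inl z => repr_germ (x z) | inr y => fun=> a i j y end.
  have -> : sol meet_formula (a' i j) x = holds meet_formula (fun z => to_germ U (u z) : M).
    by congr holds; apply/funext => -[z|//] /=; rewrite repr_germK.
  rewrite los_to_germ; last exact: finite_finset.
  split; apply: filterS => l; congr holds; apply/funext; by case.
exists a', 2; split=> [i J J2 [x xJ]|f J fJ _].
  have [tau tauI JE] := card_eq_range J2.
  have xa j : J j -> \forall l \near U, sol meet_formula (a i j) (fun z => repr_germ (x z) l).
    by move=> Jj; apply/solE/xJ.
  have J0 : J (tau ord0) by rewrite JE; exists ord0.
  have J1 : J (tau ord_max) by rewrite JE; exists ord_max.
  have [l [/sol_meet_formula H /sol_meet_formula H']] :=
    @filter_ex _ U _ _ (filterI (xa _ J0) (xa _ J1)).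
  (* This point of row [i] lies in the cell of [tau ord0] but not in that of [tau ord_max], so one
     meet with the row cannot equal both. *)
  pose w k := (k == i) || (k == (i + tau ord0).+1).
  have iw : first_at i w.
    rewrite /first_at /w eqxx /=; apply/allP => k; rewrite mem_iota add0n /= => ki.
    by rewrite negb_or !neq_ltn ki ltnS (leq_trans (ltnW ki)) ?leq_addr.
  have := H w; rewrite -H' /= iw /w eqxx orbT eqSS eqn_add2l => /esym/orP[/eqP|/eqP/tauI//].
  by move=> E; have := leq_addr (tau ord_max) i; rewrite leqNgt -[X in (_ < X)%N]E leqnn.
pose b n (l : 'I_1) : clopen_algebra := path_clopen n f.
have [k [t Jt]] := finite_set_range fJ; pose n := (\max_(l < k) t l).+1.
exists (fun l => to_germ U (fun=> b n l)) => i Ji.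
apply/solE.
have Ur : \forall l \near U, repr_germ (to_germ U (fun=> path_clopen n f)) l = path_clopen n f.
  exact: repr_to_germ.
apply: filterS Ur => l El; rewrite (_ : (fun _ => _) = fun=> path_clopen n f).
  apply: sol_path_clopen; move: Ji; rewrite Jt => -[m _ <-].
  by rewrite ltnS; exact: leq_bigmax.
by apply/funext => z.
Qed.

Theorem mainTheorem3 :
  exists (L : language) (T : set (sentence L)),
    [/\ complete T,
        has_TP2 T
      & forall (K : Type) (M : structure L), monster T K M ->
        forall A : set M, small K A -> chain_condition A].
Proof.
exists pattern_language, (theory clopen_algebra); split.
- exact: complete_theory.
- exact: clopen_has_TP2.
move=> K M [TM KL satM] A smA.
apply: (chain_condition_pattern_algebra _ _ satM smA).
  exact: pattern_algebra_models clopen_pattern_algebra TM.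
(* [K] is infinite because the iterated negations of [Bot] are pairwise distinct formulas. *)
apply: card_le_trans KL.
pose f n : formula pattern_language nat := iter n (@Not _ _) Bot.
have fI : injective f by elim=> [|i IH] [|j] //= [/IH ->].
by apply: (@card_le_inj _ _ _ f) => i j _ _ /fI.
Qed.
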